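(* Let $d\in\mathbb{N}$. (i) There exists a random variable $Q_{\max}(d)$ such that, as $n\to\infty$, $$\mathcal{O}^d_{\max}(\mathcal{U}_n)\stackrel{d}{\longrightarrow}Q_{\max}(d)\quad\text{and}\quad\mathcal{O}^d_{\max}(\Pi_n)\stackrel{d}{\longrightarrow}Q_{\max}(d).$$ (ii) When $d=1$, $$Q_{\max}(1)\stackrel{d}{=}\max\{UM^{\{1\}},(1-U)M^{\{2\}}\},$$ where $U,M^{\{1\}},M^{\{2\}}$ are independent, $U$ is uniform on $(0,1)$, and $M^{\{1\}},M^{\{2\}}$ are max-Dickman random variables. Also, as $n\to\infty$, $$\mathcal{O}^1_{\max}(\mathcal{U}^0_n)\stackrel{d}{\longrightarrow}M\quad\text{and}\quad\mathcal{O}^1_{\max}(\Pi^0_n)\stackrel{d}{\longrightarrow}M,$$ where $M$ is a max-Dickman random variable.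
   Context: $\|\cdot\|_d$ is the Euclidean norm on $\mathbb{R}^d$; $\stackrel{d}{\longrightarrow}$ and $\stackrel{d}{=}$ are convergence and equality in distribution. For a finite sequence $\mathcal{Y}_m=(\mathbf{Y}_1,\ldots,\mathbf{Y}_m)$ of points in $\mathbb{R}^d$, the on-line nearest-neighbour graph (ONG) joins each $\mathbf{Y}_i$, $i\ge2$, to its Euclidean nearest neighbour among $\mathbf{Y}_1,\ldots,\mathbf{Y}_{i-1}$. The length of its longest edge is $\mathcal{O}^d_{\max}(\mathcal{Y}_m)=\max_{2\le i\le m}\min_{1\le j<i}\|\mathbf{Y}_i-\mathbf{Y}_j\|_d$. $\mathbf{U}_1,\mathbf{U}_2,\ldots$ are independent uniform random vectors in $(0,1)^d$; $\mathcal{U}_m=(\mathbf{U}_1,\ldots,\mathbf{U}_m)$. $(N(t))_{t\ge0}$ is the counting process of a homogeneous Poisson process of unit rate on $(0,\infty)$, independent of $(\mathbf{U}_i)$, and $\Pi_n=\mathcal{U}_{N(n)}$. For $d=1$, with $U_1,U_2,\ldots$ independent uniform on $(0,1)$, $\mathcal{U}^0_n=(0,U_1,\ldots,U_n)$ and $\Pi^0_n=(0,U_1,\ldots,U_{N(n)})$. The max-Dickman distribution is the distribution of a random variable $M$ characterized by $M\stackrel{d}{=}\max\{1-U,UM\}$, where $U$ is uniform on $(0,1)$ and independent of the $M$ on the right (equivalently, the law of the first component of the Poisson--Dirichlet distribution with parameter $1$). *)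

(* Defs.v *)
From HB Require Import structures.
From mathcomp Require Export all_boot all_order all_algebra finmap.
From mathcomp Require Export all_classical all_reals all_analysis.
Export Order.TTheory GRing.Theory Num.Theory.
Export numFieldNormedType.Exports.

#[export] Set Implicit Arguments.
#[export] Unset Strict Implicit.
#[export] Unset Printing Implicit Defensive.

#[global] Open Scope classical_set_scope.
#[global] Open Scope ring_scope.

(* Points of R^d are d.-tuple R, which carries the product sigma-algebra; the
   library norm on 'rV[R]_d is the sup norm, so the Euclidean distance is
   written out. *)
Definition euclid_dist (R : realType) (d : nat) (x y : d.-tuple R) : R :=
  Num.sqrt (\sum_(k < d) (tnth x k - tnth y k) ^+ 2).

Definition origin (R : realType) (d : nat) : d.-tuple R := [tuple 0 | _ < d].
Arguments origin {R d}.

(* Indices start at 0: s`_i is Y_(i+1). The minimum is over the nonempty set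
   j < i, so taking the distance to s`_0 as its unit is harmless; all distances
   are nonnegative, so 0 only matters as the value for a graph without edges
   (at most one point). *)
Definition ong_max (R : realType) (d : nat) (s : seq (d.-tuple R)) : R :=
  \big[Num.max/0]_(1 <= i < size s)
    \big[Num.min/euclid_dist (nth origin s i) (nth origin s 0)]_(0 <= j < i)
      euclid_dist (nth origin s i) (nth origin s j).

Section Probability.
Context (dT : measure_display) (T : measurableType dT) (R : realType).
Variable P : probability T R.

Definition sigma_rv (dE : measure_display) (E : measurableType dE)
    (X : T -> E) : set_system T :=
  preimage_set_system [set: T] X measurable.

Definition indep_family (I : choiceType) (F : I -> set_system T) : Prop :=
  forall (J : {fset I}) (A : I -> set T), (forall i, i \in J -> F i (A i)) ->
    P (\bigcap_(i in [set` J]) A i) = (\prod_(i <- J) P (A i))%E.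

Definition indep2 (F G : set_system T) : Prop :=
  forall A B, F A -> G B -> P (A `&` B) = (P A * P B)%E.

Definition uniform01 (X : {RV P >-> R}) : Prop :=
  forall A, measurable A -> distribution P X A = uniform_prob (@ltr01 R) A.

(* The law of X is the d-fold product of the uniform law on (0,1), specified on
   measurable rectangles. *)
Definition uniform_cube (d : nat) (X : {RV P >-> d.-tuple R}) : Prop :=
  forall B : 'I_d -> set R, (forall k, measurable (B k)) ->
    distribution P X [set x | forall k, B k (tnth x k)] =
    (\prod_(k < d) uniform_prob (@ltr01 R) (B k))%E.

Definition iid_uniform_cube (d : nat) (U : nat -> {RV P >-> d.-tuple R}) : Prop :=
  (forall i, uniform_cube (U i)) /\ indep_family (fun i => sigma_rv (U i)).

(* N is the counting process t |-> N(t) of a unit-rate Poisson process on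
   (0, +oo); its values at negative times are irrelevant. *)
Definition unit_poisson_process (N : R -> {RV P >-> nat}) : Prop :=
  [/\ (forall w, N 0 w = 0%N),
      (forall w s t, 0 <= s -> s <= t -> (N s w <= N t w)%N),
      (forall w t, 0 <= t -> \forall s \near t^'+, N s w = N t w),
      (forall s t k, 0 <= s -> s < t ->
         P [set w | (N t w - N s w)%N = k] = (poisson_pmf (t - s) k)%:E)
    & (forall t : nat -> R, 0 <= t 0%N -> (forall i, t i <= t i.+1) ->
         indep_family (fun i => sigma_rv (fun w => (N (t i.+1) w - N (t i) w)%N)))].

(* The processes (U_i)_i and (N(t))_(t >= 0) are independent. *)
Definition indep_processes (d : nat) (U : nat -> {RV P >-> d.-tuple R})
    (N : R -> {RV P >-> nat}) : Prop :=
  indep2 <<s \bigcup_i sigma_rv (U i) >>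
         <<s \bigcup_(t in [set t | 0 <= t]) sigma_rv (N t) >>.

End Probability.

Definition eq_in_distribution (R : realType)
    (dX : measure_display) (TX : measurableType dX) (PX : probability TX R)
    (dY : measure_display) (TY : measurableType dY) (PY : probability TY R)
    (X : TX -> R) (Y : TY -> R) : Prop :=
  [/\ measurable_fun [set: TX] X, measurable_fun [set: TY] Y
    & forall A : set R, measurable A -> PX (X @^-1` A) = PY (Y @^-1` A)].

(* Measurability of the X_n is included: otherwise the integrals are meaningless. *)
Definition cvg_in_distribution (R : realType)
    (dX : measure_display) (TX : measurableType dX) (PX : probability TX R)
    (dY : measure_display) (TY : measurableType dY) (PY : probability TY R)
    (X : nat -> TX -> R) (Y : {RV PY >-> R}) : Prop :=
  (forall n, measurable_fun [set: TX] (X n)) /\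
  forall f : R -> R, continuous f -> (exists C, forall x, `|f x| <= C) ->
    'E_PX[f \o X n]%E @[n --> \oo] --> 'E_PY[f \o Y]%E.

Definition max_dickman (R : realType) (dT : measure_display)
    (T : measurableType dT) (P : probability T R) (M : {RV P >-> R}) : Prop :=
  exists (dT' : measure_display) (T' : measurableType dT')
         (P' : probability T' R) (U M' : {RV P' >-> R}),
    [/\ uniform01 U, indep2 P' (sigma_rv U) (sigma_rv M'),
        eq_in_distribution P' P M' M
      & eq_in_distribution P P' M (fun w => Num.max (1 - U w) (U w * M' w))].

(* Main.v *)
From HB Require Import structures.
Require Import Defs.
From mathcomp Require Import measurable_realfun ring lra.

(** The longest edge [O_n] of the first [n] points is nondecreasing in [n] and
    a.s. bounded by the diameter of the cube, so it converges a.s., also along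
    [N(n)] since [N(n) -> oo] a.s.  The law of [O_n] depends only on the joint
    law of the points, hence so does the law of the limit.

    In dimension 1, [O_n <= y] iff every new minimum or maximum extends the
    current range [[a, b]] by at most [y].  With [h x = P((1 - x) M <= y)], the
    identity [M = max(1 - U, U M)] in law says [(1 - x) h(x)] is the integral of
    [h] over [(x, x + y)] (within [(0, 1)]), which makes [h(b) h(1 - a)] harmonic
    for the Markov chain of the ranges killed at the first long edge.  As
    [h = 1] on [[1 - y, 1]], this function equals 1 once the range contains
    [[y, 1 - y]], which fails after [n] points with probability at most
    [2 (1 - y)^n]; so [P(O_n <= y)] converges to the mean of [h(b) h(1 - a)] at
    the initial range.  The same integral identity is a contraction of factor
    [1 - y], hence determines [h], and with it the max-Dickman law.

    No infinite product space is built: if no iid uniform sequence exists, then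
    the convergence statements are vacuous and only the law of the limit in
    dimension 1 is constrained. *)

(** * Measures and independence *)

(** These rays are stable under intersection and generate the Borel sets, and countably many of
    them, each of finite mass, cover the line. *)
Lemma finite_measure_eq_itvoy (R : realType) (m1 m2 : {measure set R -> \bar R}) :
  (forall x, m1 `]x, +oo[%classic < +oo)%E ->
  (forall x, m1 `]x, +oo[%classic = m2 `]x, +oo[%classic) ->
  forall A, measurable A -> m1 A = m2 A.
Proof.
move=> fin eqm A mA.
apply: (measure_unique (@RGenOInfty.G R) (fun n => `](- n%:R), +oo[%classic)) => //.
- exact: RGenOInfty.measurableE.
- move=> _ _ [x ->] [y ->]; exists (Num.max x y).
  apply/seteqP; split => z /=; rewrite !in_itv/= !andbT gt_max.
    by move=> [-> ->].
  by move=> /andP[].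
- by move=> i; exists (- i%:R).
- apply/seteqP; split => // x _; exists (Num.truncn (- x)).+1 => //=.
  by rewrite in_itv/= andbT ltrNl truncnS_gt.
- by move=> _ [x ->].
Qed.

(** Boxes are stable under intersection, contain the whole space and generate the product
    sigma-algebra. *)
Lemma finite_measure_eq_box (R : realType) (d : measure_display)
    (E : measurableType d) (n : nat)
    (m1 m2 : {measure set (n.-tuple E) -> \bar R}) :
  (m1 setT < +oo)%E ->
  (forall B : 'I_n -> set E, (forall k, measurable (B k)) ->
    m1 [set x | forall k, B k (tnth x k)] = m2 [set x | forall k, B k (tnth x k)]) ->
  forall A, measurable A -> m1 A = m2 A.
Proof.
move=> fin eqm A mA.
pose G := [set A : set (n.-tuple E) | exists2 B : 'I_n -> set E,
  (forall k, measurable (B k)) & A = [set x | forall k, B k (tnth x k)]].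
apply: (measure_unique G (fun=> setT)) => //.
- apply/seteqP; split.
    apply: smallest_sub; first exact: smallest_sigma_algebra.
    move=> C /=; rewrite -bigcup_seq => -[i _] [D mD <-].
    apply: sub_sigma_algebra.
    (* A cylinder over coordinate [i] is a box whose other sides are full. *)
    exists (fun k => if k == i then D else setT).
      by move=> k; case: ifP.
    rewrite setTI; apply/seteqP; split => x /=.
      by move=> Dx k; case: ifPn => // /eqP ->.
    by move=> /(_ i); rewrite eqxx.
  apply: smallest_sub; first exact: sigma_algebra_measurable.
  move=> _ [B mB ->].
  rewrite (_ : [set _ | _] =
      \big[setI/setT]_(k < n) ((fun x : n.-tuple E => tnth x k) @^-1` B k)).
    apply: bigsetI_measurable => k _; rewrite -[X in measurable X]setTI.
    exact: measurable_tnth.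
  rewrite -bigcap_seq; apply/seteqP; split => x /=.
    by move=> h k _; exact: h.
  by move=> h k; apply: h; rewrite /= mem_index_enum.
- move=> _ _ [B mB ->] [C mC ->]; exists (fun k => B k `&` C k).
    by move=> k; exact: measurableI.
  apply/seteqP; split => x /=.
    by move=> [h1 h2] k; split.
  by move=> h; split => k; have [] := h k.
- by move=> _; exists (fun=> setT) => //; apply/seteqP; split.
- by apply/seteqP; split => // x _; exists 0%N.
- by move=> _ [B mB ->]; exact: eqm.
Qed.

(** The law of the pair agrees with [distribution P X \x m] on rectangles, hence everywhere, and
    Tonelli's theorem applies. The law of [Y] enters as a separate measure [m], so that [unif01] can
    be plugged in directly. *)
Lemma integral_indep_pair (R : realType) (d d1 d2 : measure_display)
    (T : measurableType d) (E : measurableType d1) (F : measurableType d2)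
    (P : probability T R) (X : {mfun T >-> E}) (Y : {mfun T >-> F})
    (m : probability F R) (f : E * F -> \bar R) :
  (forall A B, measurable A -> measurable B ->
    P (X @^-1` A `&` Y @^-1` B) = (P (X @^-1` A) * m B)%E) ->
  measurable_fun setT f -> (forall z, 0 <= f z)%E ->
  (\int[P]_w f (X w, Y w) = \int[P]_w \int[m]_y f (X w, y))%E.
Proof.
move=> ind mf f0.
have mXY : measurable_fun setT (fun w => (X w, Y w)).
  exact: measurable_fun_pair.
pose XY : {mfun T >-> (E * F)%type} := HB.pack (fun w => (X w, Y w))
  (isMeasurableFun.Build _ _ _ _ _ mXY).
rewrite -[LHS](@ge0_integral_distribution _ _ _ _ _ P XY)//.
rewrite (eq_measure_integral (distribution P X \x m)%E); last first.
  move=> A mA _; apply/esym; apply: product_measure_unique => // B C mB mC; exact: ind.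
rewrite fubini_tonelli1//.
rewrite (@ge0_integral_distribution _ _ _ _ _ P X)//.
  exact: measurable_fun_fubini_tonelli_F.
by move=> x; apply: integral_ge0.
Qed.

Lemma prob_indep_pair (R : realType) (d d1 d2 : measure_display)
    (T : measurableType d) (E : measurableType d1) (F : measurableType d2)
    (P : probability T R) (X : {mfun T >-> E}) (Y : {mfun T >-> F})
    (m : probability F R) (D : set (E * F)) :
  (forall A B, measurable A -> measurable B ->
    P (X @^-1` A `&` Y @^-1` B) = (P (X @^-1` A) * m B)%E) ->
  measurable D ->
  (P [set w | D (X w, Y w)] = \int[P]_w m [set y | D (X w, y)])%E.
Proof.
move=> ind mD.
have mXY : measurable [set w | D (X w, Y w)].
  rewrite -[X in measurable X]setTI.
  exact: (measurable_fun_pair (measurable_funPT X) (measurable_funPT Y)).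
transitivity (\int[P]_w (\1_D (X w, Y w))%:E)%E.
  transitivity (\int[P]_w (\1_[set w | D (X w, Y w)] w)%:E)%E; last by [].
  by rewrite integral_indic// setIT.
rewrite (integral_indep_pair (m := m) (f := fun z => (\1_D z)%:E))//.
  apply: eq_integral => w _.
  have := integral_indic m measurableT (measurable_xsection (X w) mD).
  rewrite setIT (_ : xsection D (X w) = [set y | D (X w, y)]); last first.
    by apply/seteqP; split => y; rewrite /xsection/= inE.
  move=> <-; apply: eq_integral => y _; rewrite !indicE; congr ((nat_of_bool _)%:R%:E).
by apply/measurable_EFinP; exact: measurable_indic.
Qed.

(** * The uniform law on the unit interval *)

Section uniform01_measure.
Variable R : realType.

Let measurable_idR : measurable_fun setT (idfun : measurableTypeR R -> R).
Proof. exact: measurable_id. Qed.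

(* [uniform_prob] lives on the alias [measurableTypeR R]; this is its copy on
   [R] with the structure that random variables use. *)
Definition unif01 : probability R R :=
  distribution (uniform_prob (@ltr01 R))
    (HB.pack_for {mfun measurableTypeR R >-> R} (idfun : measurableTypeR R -> R)
      (isMeasurableFun.Build _ _ _ _ _ measurable_idR)).

Lemma unif01E (A : set R) : unif01 A = uniform_prob (@ltr01 R) A.
Proof. by []. Qed.

Arguments unif01 : simpl never.

Lemma unif01_lebesgue (A : set R) : measurable A ->
  unif01 A = lebesgue_measure (A `&` `[0, 1]%classic).
Proof.
move=> mA; rewrite unif01E /uniform_prob integral_uniform_pdf.
rewrite (eq_integral (fun=> 1%E)).
  by rewrite integral_cst ?mul1e//; exact: measurableI.
move=> x; rewrite inE /= => -[_]; rewrite in_itv/= /uniform_pdf => ->.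
by rewrite subr0 invr1.
Qed.

(** The map [u |-> 1 - (1 - b) * u] sends the unit interval onto [[b, 1]] and scales length by
    [1 - b]. It reverses orientation, so that [b = 0] is the reflection. *)
Lemma unif01_affine (b : R) (A : set R) : 0 <= b <= 1 -> measurable A ->
  ((1 - b)%:E * unif01 ((fun u => 1 - (1 - b) * u)%R @^-1` A) =
   unif01 (A `&` `]b, +oo[%classic))%E.
Proof.
move=> /andP[b0 b1] mA.
have mT : measurable_fun setT (fun u : R => 1 - (1 - b) * u).
  by apply: measurable_funB => //; apply: measurable_funM.
pose Tm : {mfun R >-> R} := HB.pack (fun u : R => 1 - (1 - b) * u)
  (isMeasurableFun.Build _ _ _ _ _ mT).
have b1' : 0 <= 1 - b by rewrite subr_ge0.
pose c : {nonneg R} := NngNum b1'.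
pose m1 := mscale c (distribution unif01 Tm).
have mb : measurable (`]b, +oo[%classic : set R) by [].
pose m2 := mrestr unif01 mb.
apply: (finite_measure_eq_itvoy (m1 := m1) (m2 := m2)) => // {mA A} [x|x].
  apply: (@le_lt_trans _ _ c%:num%:E); last exact: ltry.
  by rewrite -[leRHS]mule1 lee_wpmul2l ?probability_le1// lee_fin.
rewrite -[LHS]/((1 - b)%:E * unif01 ((fun u => 1 - (1 - b) * u)%R @^-1` `]x, +oo[))%E.
rewrite -[RHS]/(unif01 (`]x, +oo[ `&` `]b, +oo[)).
rewrite !unif01_lebesgue//; last 2 first.
- exact: measurableI.
- exact: (measurable_funPTI Tm).
have -> : (`]x, +oo[ `&` `]b, +oo[ `&` `[0, 1])%classic =
    `](Num.max x b), 1]%classic :> set R.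
  apply/seteqP; split => z /=; rewrite !in_itv/= ?andbT gt_max.
    by move=> [[-> ->] /andP[_ ->]].
  move=> /andP[/andP[-> bz] z1]; split => //.
  by rewrite z1 andbT (le_trans b0)// ltW.
(* For [b = 1] both sides vanish; otherwise division by [1 - b] is possible. *)
move: b1; rewrite le_eqVlt => /predU1P[b1|b1].
  rewrite b1 subrr mul0e lebesgue_measure_itv/= lte_fin.
  by rewrite ltNge le_max lexx orbT.
have b1p : 0 < 1 - b by rewrite subr_gt0.
have [x1|x1] := leP 1 x.
  have -> : (`](Num.max x b), 1] = set0 :> set R)%classic.
    by rewrite set_itv_ge// bnd_simp -leNgt le_max x1.
  have -> : ((fun u => (1 - (1 - b) * u)%R) @^-1` `]x, +oo[ `&` `[0, 1] = set0 :> set R)%classic.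
    apply/seteqP; split => // u /= []; rewrite !in_itv/= andbT => xu /andP[u0 u1].
    by move: xu; apply/negP; rewrite -leNgt; nra.
  by rewrite !measure0 mule0.
have -> : ((fun u => (1 - (1 - b) * u)%R) @^-1` `]x, +oo[ `&` `[0, 1] =
     if x < b then `[0%R, 1%R] else `[0%R, ((1 - x) / (1 - b))%R[ :> set R)%classic.
  apply/seteqP; case: ifPn => xb; split => u /=; rewrite !in_itv/= ?andbT.
  - by move=> [].
  - by move=> /andP[u0 u1]; split; rewrite ?u0//; nra.
  - by move=> [xu /andP[u0 u1]]; rewrite u0 ltr_pdivlMr//=; nra.
  - move: xb; rewrite -leNgt => xb.
    move=> /andP[u0]; rewrite ltr_pdivlMr// => h; rewrite u0/=; split; first nra.
    by rewrite -(@ler_pM2r _ (1 - b))//; lra.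
case: ifPn => xb.
  rewrite max_r ?ltW// !lebesgue_measure_itv/= !lte_fin b1 ltr01.
  by rewrite sube0 mule1 EFinB.
rewrite -leNgt in xb; rewrite max_l// !lebesgue_measure_itv/= !lte_fin x1.
rewrite divr_gt0 ?subr_gt0// sube0 -EFinM -EFinB; congr (_%:E).
by rewrite mulrC divfK// gt_eqF.
Qed.

End uniform01_measure.

(** * The longest edge *)

Section longest_edge.
Variables (R : realType) (d : nat).
Implicit Types (s : seq (d.-tuple R)) (y : R).

(** The conjunct [0 <= y] accounts for the default value 0 of the maximum, which is all that remains
    of a graph without edges. *)
Lemma ong_max_leP s y :
  (ong_max s <= y) <->
  (0 <= y /\ forall i, (0 < i < size s)%N ->
     exists2 j, (j < i)%N & euclid_dist (nth origin s i) (nth origin s j) <= y).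
Proof.
rewrite /ong_max; split.
  move=> h; split; first exact: le_trans (bigmax_ge_id _ _ _ _) h.
  move=> i /andP[i0 si].
  have /le_trans-/(_ _ h) :
      \big[Num.min/euclid_dist (nth origin s i) (nth origin s 0)]_(0 <= j < i)
        euclid_dist (nth origin s i) (nth origin s j) <=
      \big[Num.max/0]_(1 <= i < size s)
        \big[Num.min/euclid_dist (nth origin s i) (nth origin s 0)]_(0 <= j < i)
          euclid_dist (nth origin s i) (nth origin s j).
    apply: (@order.Order.TotalTheory.bigmax_sup_seq _ _ _ _ _ i) => //.
    by rewrite mem_index_iota i0.
  (* The first case bounds the default of the minimum, the distance to the first point; that point
     is an admissible neighbour because [0 < i]. *)
  rewrite big_mkord => /bigmin_leP[h0|[j _ hj]]; first by exists 0%N.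
  by exists j.
move=> [y0 h]; rewrite big_seq; apply: bigmax_le => // i.
rewrite mem_index_iota => /h[j ji hj].
apply: (@order.Order.TotalTheory.bigmin_inf_seq _ _ _ _ _ j) => //.
by rewrite mem_index_iota.
Qed.

Lemma ong_max_ge0 s : 0 <= ong_max s.
Proof. exact: bigmax_ge_id. Qed.

(** Later points do not alter the edges drawn by earlier ones. *)
Lemma ong_max_mkseq_nd (x : nat -> d.-tuple R) :
  {homo (fun n => ong_max (mkseq x n)) : m n / (m <= n)%N >-> m <= n}.
Proof.
move=> m n mn; apply/ong_max_leP; split; first exact: ong_max_ge0.
move=> i; rewrite size_mkseq => /andP[i0 im].
have i_n := leq_trans im mn.
have /ong_max_leP[_ /(_ i)] := lexx (ong_max (mkseq x n)).
rewrite size_mkseq i0 i_n => /(_ isT)[j ji h]; exists j => //.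
have j_m := ltn_trans ji im; have j_n := ltn_trans ji i_n.
by move: h; rewrite !nth_mkseq.
Qed.

(** The first point is always a witness, since no two points of the cube are farther apart than its
    diagonal. *)
Lemma ong_max_cube s :
  (forall x, x \in s -> forall k, 0 <= tnth x k <= 1) ->
  ong_max s <= Num.sqrt d%:R.
Proof.
move=> h; apply/ong_max_leP; split; first exact: sqrtr_ge0.
move=> i /andP[i0 si]; exists 0%N => //; apply: ler_wsqrtr.
rewrite -[d in leRHS]card_ord -sum1_card natr_sum; apply: ler_sum => k _.
have /h/(_ k)/andP[? ?] := mem_nth origin si.
have /h/(_ k)/andP[? ?] := mem_nth origin (ltn_trans i0 si).
rewrite -[leRHS]/(1 : R); nra.
Qed.

Lemma measurable_bigminr (dT : measure_display) (T : measurableType dT)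
    (I : Type) (r : seq I) (f : I -> T -> R) (g : T -> R) :
  measurable_fun setT g -> (forall i, measurable_fun setT (f i)) ->
  measurable_fun setT (fun w => \big[Num.min/g w]_(i <- r) f i w).
Proof.
move=> mg mf; elim: r => [|a r ih].
  by under eq_fun do rewrite big_nil.
by under eq_fun do rewrite big_cons; exact: measurable_minr.
Qed.

Lemma measurable_bigmaxr (dT : measure_display) (T : measurableType dT)
    (I : Type) (r : seq I) (f : I -> T -> R) (g : T -> R) :
  measurable_fun setT g -> (forall i, measurable_fun setT (f i)) ->
  measurable_fun setT (fun w => \big[Num.max/g w]_(i <- r) f i w).
Proof.
move=> mg mf; elim: r => [|a r ih].
  by under eq_fun do rewrite big_nil.
by under eq_fun do rewrite big_cons; exact: measurable_maxr.
Qed.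

Lemma measurable_euclid_dist (dT : measure_display) (T : measurableType dT)
    (X Y : T -> d.-tuple R) :
  measurable_fun setT X -> measurable_fun setT Y ->
  measurable_fun setT (fun w => euclid_dist (X w) (Y w)).
Proof.
move=> mX mY.
have msqrt : measurable_fun [set: R] (@Num.sqrt R).
  by apply: continuous_measurable_fun; exact: sqrt_continuous.
apply: (measurableT_comp msqrt).
apply: measurable_sum => k; apply: measurable_funX; apply: measurable_funB.
- exact: (measurableT_comp (measurable_tnth k)).
- exact: (measurableT_comp (measurable_tnth k)).
Qed.

Lemma measurable_ong_max (dT : measure_display) (T : measurableType dT)
    (X : nat -> T -> d.-tuple R) n :
  (forall i, measurable_fun setT (X i)) ->
  measurable_fun setT (fun w => ong_max (mkseq (X ^~ w) n)).
Proof.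
move=> mX.
have mN i : measurable_fun setT (fun w => nth origin (mkseq (X ^~ w) n) i).
  have [ni|ni] := ltnP i n.
    by under eq_fun do rewrite nth_mkseq//; exact: mX.
  by under eq_fun do rewrite nth_default ?size_mkseq//; exact: measurable_cst.
rewrite /ong_max; under eq_fun do rewrite size_mkseq.
apply: measurable_bigmaxr => // i; apply: measurable_bigminr.
  exact: measurable_euclid_dist.
by move=> j; exact: measurable_euclid_dist.
Qed.

End longest_edge.

(** * Long edges and the running range in dimension 1 *)

Section one_dimension.
Variables (R : realType).
Implicit Types (x : nat -> R) (y t : R).

Fixpoint run_min x n := if n is m.+1 then Num.min (run_min x m) (x n) else x 0%N.
Fixpoint run_max x n := if n is m.+1 then Num.max (run_max x m) (x n) else x 0%N.

(** Only the running range is consulted, which makes this flag together with the range a Markov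
    chain. For [0 <= y] the flag says that no edge longer than [y] has appeared among the points 0
    to [n]. *)
Fixpoint short_records y x n : bool :=
  if n is m.+1 then
    short_records y x m && (run_min x m - y <= x n <= run_max x m + y)
  else true.

(* Points that are not records need no separate treatment: under
   [short_records], the [y]-neighbourhood of the points is an interval. *)
Lemma short_records_cover y x n t : 0 <= y -> short_records y x n ->
  (exists2 j, (j <= n)%N & `|t - x j| <= y) <->
  (run_min x n - y <= t <= run_max x n + y).
Proof.
move=> y0; elim: n t => [|n ih] t /=.
  move=> _; split=> [[j]|h].
    by rewrite leqn0 => /eqP ->; rewrite ler_norml => /andP[h1 h2]; apply/andP; split; lra.
  by exists 0%N => //; rewrite ler_norml; move/andP: h => [h1 h2]; apply/andP; split; lra.
move=> /andP[ok /andP[xl xu]]; split.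
  move=> [j]; rewrite leq_eqVlt => /predU1P[->|jn] h.
    move: h; rewrite ler_norml => /andP[h1 h2].
    have : Num.min (run_min x n) (x n.+1) <= x n.+1 by rewrite ge_min lexx orbT.
    have : x n.+1 <= Num.max (run_max x n) (x n.+1) by rewrite le_max lexx orbT.
    by lra.
  have /andP[h1 h2] : run_min x n - y <= t <= run_max x n + y by apply/ih => //; exists j.
  have : Num.min (run_min x n) (x n.+1) <= run_min x n by rewrite ge_min lexx.
  have : run_max x n <= Num.max (run_max x n) (x n.+1) by rewrite le_max lexx.
  by lra.
move=> ht.
(* Outside the old neighbourhood only the new point, then a new extreme, can be near [t]; as it lies
   within [y] of the old range, no gap is left in between. *)
have [h1|h1] := leP (run_min x n - y) t; last first.
  exists n.+1 => //; rewrite ler_norml; move: ht; rewrite minEle; case: ifPn; lra.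
have [h2|h2] := leP t (run_max x n + y); last first.
  exists n.+1 => //; rewrite ler_norml; move: ht; rewrite maxEle; case: ifPn; lra.
by have [|j jn hj] := (ih t ok).2; rewrite ?h1//; exists j => //; exact: leq_trans jn _.
Qed.

(** By [short_records_cover], an earlier point within [y] exists exactly when the new point lies
    within [y] of the current range. *)
Lemma short_recordsP y x n : 0 <= y -> short_records y x n <->
  forall i, (0 < i <= n)%N -> exists2 j, (j < i)%N & `|x i - x j| <= y.
Proof.
move=> y0; elim: n => [|n ih] /=.
  by split => // _ [|i].
split.
  move=> /andP[ok h] i /andP[i0]; rewrite leq_eqVlt => /predU1P[->|ilt].
    by have [j jn hj] := (short_records_cover _ y0 ok).2 h; exists j.
  by apply: ih.1 => //; rewrite i0.
move=> h; have ok : short_records y x n.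
  by apply/ih => i /andP[i0 ilt]; apply: h; rewrite i0 (leq_trans ilt).
rewrite ok/=; apply/(short_records_cover _ y0 ok).
by have [j jn hj] := h n.+1 (ltnSn _); exists j.
Qed.

Lemma euclid_dist1 (a b : R) : euclid_dist [tuple a] [tuple b] = `|a - b|.
Proof. by rewrite /euclid_dist big_ord1 sqrtr_sqr. Qed.

(** Mind the shift: [short_records y x n] concerns [n.+1] points. *)
Lemma ong_max_le_short_records y x n : 0 <= y ->
  (ong_max (mkseq (fun i => [tuple x i]) n.+1) <= y) = short_records y x n.
Proof.
move=> y0; apply/idP/idP.
  move=> /ong_max_leP[_ h]; apply/short_recordsP => // i /andP[i0 ilt].
  have [|j ji] := h i; first by rewrite size_mkseq i0.
  by rewrite !nth_mkseq// ?(ltn_trans ji)// euclid_dist1; exists j.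
move=> /(short_recordsP _ _ y0) h; apply/ong_max_leP; split => // i.
rewrite size_mkseq => /andP[i0 ilt]; have [|j ji hj] := h i; first by rewrite i0.
by exists j => //; rewrite !nth_mkseq// ?(ltn_trans ji)// euclid_dist1.
Qed.

Lemma run_min_le_max x n : run_min x n <= run_max x n.
Proof.
by elim: n => //= n ih; rewrite ge_min !le_max ih.
Qed.

Lemma run_minmax_itv x n : (forall i, (i <= n)%N -> 0 <= x i <= 1) ->
  0 <= run_min x n /\ run_max x n <= 1.
Proof.
elim: n => [|n ih] /= h; first by have /andP[] := h 0%N isT.
have [|h1 h2] := ih; first by move=> i ilt; apply: h; exact: leq_trans ilt _.
by have /andP[h3 h4] := h n.+1 (leqnn _); rewrite le_min ge_max h1 h2 h3 h4.
Qed.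

Lemma run_eq (x x' : nat -> R) n : (forall i, (i <= n)%N -> x i = x' i) ->
  run_min x n = run_min x' n /\ run_max x n = run_max x' n.
Proof.
elim: n => [|n ih] h /=; first by rewrite h.
have [|-> ->] := ih; last by rewrite h.
by move=> i ilt; apply: h; exact: leq_trans ilt _.
Qed.

Lemma short_records_eq y (x x' : nat -> R) n :
  (forall i, (i <= n)%N -> x i = x' i) ->
  short_records y x n = short_records y x' n.
Proof.
elim: n => [//|n ih] h /=.
have h' i : (i <= n)%N -> x i = x' i by move=> ilt; apply: h; exact: leq_trans ilt _.
by have [-> ->] := run_eq h'; rewrite ih// h.
Qed.

End one_dimension.

(** * Almost sure limits and identically distributed sequences *)

(** Dominated convergence, with the bound of [f] as dominating constant. *)
Lemma expectation_cvg_ae (dT : measure_display) (T : measurableType dT)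
    (R : realType) (P : probability T R) (X : nat -> T -> R) (Y : T -> R)
    (f : R -> R) :
  (forall n, measurable_fun setT (X n)) -> measurable_fun setT Y ->
  (\forall w \ae P, X ^~ w @ \oo --> Y w) ->
  continuous f -> (exists C, forall x, `|f x| <= C) ->
  'E_P[f \o X n]%E @[n --> \oo] --> 'E_P[f \o Y]%E.
Proof.
move=> mX mY XY cf [C fC]; rewrite unlock.
have mf : measurable_fun setT f by exact: continuous_measurable_fun.
have [|||||_ _] := @dominated_convergence _ _ _ P _ measurableT
  (fun n w => (f (X n w))%:E) (fun w => (f (Y w))%:E) (cst C%:E); last exact.
- by move=> n; apply/measurable_EFinP; exact: measurableT_comp.
- by apply/measurable_EFinP; exact: measurableT_comp.
- apply: filterS XY => w XY _; apply: cvg_EFin; first exact: nearW.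
  by apply: continuous_cvg => //; exact: cf.
- exact: finite_measure_integrable_cst.
- by apply: aeW => w n _; rewrite lee_fin.
Qed.

Lemma expectation_eq_law (R : realType) (dE d1 d2 : measure_display)
    (E : measurableType dE) (T1 : measurableType d1) (T2 : measurableType d2)
    (P1 : probability T1 R) (P2 : probability T2 R)
    (X1 : {mfun T1 >-> E}) (X2 : {mfun T2 >-> E}) (f : E -> R) :
  measurable_fun setT f -> (exists C, forall x, `|f x| <= C) ->
  (forall A, measurable A -> P1 (X1 @^-1` A) = P2 (X2 @^-1` A)) ->
  'E_P1[f \o X1]%E = 'E_P2[f \o X2]%E.
Proof.
move=> mf [C fC] eqP; rewrite unlock.
have bint d' (T' : measurableType d') (P' : probability T' R) (X' : {mfun T' >-> E}) :
    P'.-integrable setT ((EFin \o f) \o X').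
  apply: measurable_bounded_integrable => //.
  - by rewrite (le_lt_trans (probability_le1 _ _)) ?ltry.
  - exact: measurableT_comp.
  - exists C; split; first exact: num_real.
    by move=> x Cx w _ /=; rewrite (le_trans (fC _))// ltW.
have mEf : measurable_fun setT (EFin \o f) by exact/measurable_EFinP.
rewrite -[LHS](@integral_distribution _ _ _ _ _ P1 X1 _ mEf (bint _ _ P1 X1)).
rewrite -[RHS](@integral_distribution _ _ _ _ _ P2 X2 _ mEf (bint _ _ P2 X2)).
by apply: eq_measure_integral => A mA _; exact: eqP.
Qed.

(* The truncation at [C] guarantees convergence off the null set where the
   sequence may be unbounded. *)
Definition cap_lim (R : realType) (T : Type) (C : R) (O : nat -> T -> R) (w : T) : R :=
  limn (fun n => Num.min (O n w) C).

Section cap_lim.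
Context (R : realType) (dT : measure_display) (T : measurableType dT).
Variables (P : probability T R) (C : R) (O : nat -> T -> R).
Hypotheses (mO : forall n, measurable_fun setT (O n))
  (ndO : forall w, {homo O ^~ w : m n / (m <= n)%N >-> m <= n}).

Lemma cap_lim_cvg w : Num.min (O n w) C @[n --> \oo] --> cap_lim C O w.
Proof.
apply: nondecreasing_is_cvgn.
  by move=> m n mn; rewrite le_min ge_min ndO//= ge_min lexx orbT.
by exists C => _ [n _ <-]; rewrite ge_min lexx orbT.
Qed.

Lemma measurable_cap_lim : measurable_fun setT (cap_lim C O).
Proof.
apply: (measurable_fun_cvg (h := fun n w => Num.min (O n w) C)).
  by move=> n; exact: measurable_minr.
by move=> w _; exact: cap_lim_cvg.
Qed.

(** Below [C] the truncation is invisible, and a nondecreasing sequence stays below its limit. *)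
Lemma le_cap_lim y w : y < C ->
  (cap_lim C O w <= y) <-> (forall n, O n w <= y).
Proof.
move=> yC; have nd : {homo (fun n => Num.min (O n w) C) : m n / (m <= n)%N >-> m <= n}.
  by move=> m n mn; rewrite le_min ge_min ndO//= ge_min lexx orbT.
split=> [h n|h].
  have : Num.min (O n w) C <= y.
    apply: le_trans h; apply: (nondecreasing_cvgn_le nd).
    by apply/cvg_ex; exists (cap_lim C O w); exact: cap_lim_cvg.
  by rewrite ge_min => /orP[//|]; rewrite leNgt yC.
apply: limr_le; first by apply/cvg_ex; exists (cap_lim C O w); exact: cap_lim_cvg.
by apply: nearW => n; rewrite ge_min h.
Qed.

Hypothesis bO : \forall w \ae P, forall n, O n w <= C.

(** Convergence holds path by path, so it passes to any index that tends to infinity along the same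
    path. *)
Lemma cap_lim_cvg_ae (K : nat -> T -> nat) :
  (\forall w \ae P, forall k, exists n0, forall n, (n0 <= n)%N -> (k <= K n w)%N) ->
  \forall w \ae P, O (K n w) w @[n --> \oo] --> cap_lim C O w.
Proof.
move=> Kinf; apply: filterS2 bO Kinf => w bw Kw.
have cO : O n w @[n --> \oo] --> cap_lim C O w.
  have := @cap_lim_cvg w.
  by under eq_fun do rewrite (min_l (bw _)).
apply: cvg_comp cO => A [k _ kA].
have [n0 hn0] := Kw k.
by exists n0 => // n /= n0n; apply: kA => /=; exact: hn0.
Qed.

(** Continuity from above: the events decrease with [n], and by [le_cap_lim] their intersection is
    the event of the limit. *)
Lemma cap_lim_leE y : y < C ->
  P [set w | O n w <= y] @[n --> \oo] --> P [set w | cap_lim C O w <= y].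
Proof.
move=> yC.
rewrite (_ : [set w | cap_lim C O w <= y] = \bigcap_n [set w | O n w <= y]); last first.
  apply/seteqP; split => w /=; first by move=> /(le_cap_lim _ yC) h n _; exact: h.
  by move=> h; apply/le_cap_lim => // n; exact: h.
have mF n : measurable [set w | O n w <= y].
  rewrite -[X in measurable X]setTI -[X in _ `&` X]/(O n @^-1` [set x | x <= y]).
  apply: mO => //; rewrite -set_itvNyc //.
apply: nonincreasing_cvg_mu => //.
- by rewrite (le_lt_trans (probability_le1 _ _))// ltry.
- exact: bigcapT_measurable.
- by move=> m n mn; apply/subsetPset => w /=; apply: le_trans; exact: ndO.
Qed.

End cap_lim.

(** * Laws of finite prefixes of an iid uniform sequence *)

Section iid.
Context (R : realType) (dT : measure_display) (T : measurableType dT).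
Variables (P : probability T R).

Lemma indep_family_prefix (dE : measure_display) (E : measurableType dE)
    (U : nat -> T -> E) (B : nat -> set E) n :
  indep_family P (fun i => sigma_rv (U i)) -> (forall i, measurable (B i)) ->
  P [set w | forall i, (i < n)%N -> B i (U i w)] = (\prod_(i < n) P (U i @^-1` B i))%E.
Proof.
move=> ind mB.
pose J := [fset i in iota 0 n]%fset.
have Jin i : (i \in J) = (i < n)%N by rewrite !inE /= mem_iota.
have -> : (\prod_(i < n) P (U i @^-1` B i) = \prod_(i <- J) P (U i @^-1` B i))%E.
  rewrite -(big_mkord xpredT (fun i => P (U i @^-1` B i))) /index_iota subn0.
  apply: perm_big; apply: uniq_perm; rewrite ?iota_uniq ?fset_uniq// => i.
  by rewrite Jin mem_iota.
rewrite -ind => [|i _]; last by exists (B i) => //; rewrite setTI.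
congr (P _); apply/seteqP; split => w /= h i.
  by rewrite /= Jin; exact: h.
by move=> ilt; apply: h; rewrite /= Jin.
Qed.

Lemma uniform_cube_unit d (X : {RV P >-> d.-tuple R}) : uniform_cube X ->
  \forall w \ae P, forall k, 0 <= tnth (X w) k <= 1.
Proof.
move=> uX.
pose A : set (d.-tuple R) := [set x | forall k, `[0, 1]%classic (tnth x k)].
have PA : P (X @^-1` A) = 1%E.
  rewrite [LHS](uX (fun=> `[0, 1]%classic))// big1// => k _.
  by rewrite -unif01E unif01_lebesgue// setIid lebesgue_measure_itv/= lte_fin ltr01 sube0.
have mA : measurable (X @^-1` A).
  rewrite -[X in measurable X]setTI.
  rewrite (_ : A = \bigcap_(k in setT) ((fun x : d.-tuple R => tnth x k) @^-1` `[0, 1]%classic)).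
    apply: measurable_funPT => //.
    apply: fin_bigcap_measurable => [|k _]; first exact: finite_finset.
    by rewrite -[X in measurable X]setTI; exact: measurable_tnth.
  by apply/seteqP; split => x /= h k; [move=> _|]; exact: h.
exists (~` (X @^-1` A)); split.
- exact: measurableC.
- by rewrite probability_setC// PA subee.
- by move=> w /=; apply: contra_not => h k; have := h k; rewrite /= in_itv.
Qed.

End iid.

Section iid_law.
Variables (R : realType) (d : nat).

Lemma uniform_cube_law (d1 d2 : measure_display) (T1 : measurableType d1)
    (T2 : measurableType d2) (P1 : probability T1 R) (P2 : probability T2 R)
    (X1 : {RV P1 >-> d.-tuple R}) (X2 : {RV P2 >-> d.-tuple R}) :
  uniform_cube X1 -> uniform_cube X2 ->
  forall A, measurable A -> P1 (X1 @^-1` A) = P2 (X2 @^-1` A).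
Proof.
move=> u1 u2.
apply: (finite_measure_eq_box (m1 := distribution P1 X1) (m2 := distribution P2 X2)).
  by rewrite (le_lt_trans (probability_le1 _ _)) ?ltry.
by move=> B mB; exact: etrans (u1 B mB) (esym (u2 B mB)).
Qed.

Lemma measurable_prefix (dT dE : measure_display) (T : measurableType dT)
    (E : measurableType dE) (U : nat -> {mfun T >-> E}) n :
  measurable_fun setT (fun w => [tuple U i w | i < n]).
Proof.
apply/measurable_fun_tnthP => i.
rewrite (_ : _ \o _ = U i); first exact: measurable_funPT.
by apply/funext => w /=; rewrite tnth_mktuple.
Qed.

Lemma iid_prefix_law (d1 d2 : measure_display) (T1 : measurableType d1)
    (T2 : measurableType d2) (P1 : probability T1 R) (P2 : probability T2 R)
    (U1 : nat -> {RV P1 >-> d.-tuple R}) (U2 : nat -> {RV P2 >-> d.-tuple R}) n :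
  iid_uniform_cube U1 -> iid_uniform_cube U2 ->
  forall A, measurable A ->
    P1 [set w | A [tuple U1 i w | i < n]] = P2 [set w | A [tuple U2 i w | i < n]].
Proof.
move=> [u1 i1] [u2 i2].
pose V1 : {mfun T1 >-> n.-tuple (d.-tuple R)} := HB.pack (fun w => [tuple U1 i w | i < n])
  (isMeasurableFun.Build _ _ _ _ _ (measurable_prefix U1 (n := n))).
pose V2 : {mfun T2 >-> n.-tuple (d.-tuple R)} := HB.pack (fun w => [tuple U2 i w | i < n])
  (isMeasurableFun.Build _ _ _ _ _ (measurable_prefix U2 (n := n))).
apply: (finite_measure_eq_box (m1 := distribution P1 V1) (m2 := distribution P2 V2)).
  by rewrite (le_lt_trans (probability_le1 _ _)) ?ltry.
move=> B mB.
(* The sides of the box are continued by [setT] to a sequence of sets, the format of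
   [indep_family_prefix]. *)
pose B' (i : nat) : set (d.-tuple R) := if insub i is Some k then B k else setT.
have mB' i : measurable (B' i) by rewrite /B'; case: insub.
have BE T (V : T -> nat -> d.-tuple R) w :
    (forall k : 'I_n, B k (tnth [tuple V w i | i < n] k)) <-> (forall i, (i < n)%N -> B' i (V w i)).
  split=> [h i ilt|h k]; first by rewrite /B' insubT; have := h (Ordinal ilt); rewrite tnth_mktuple.
  by have := h k (ltn_ord k); rewrite /B' valK tnth_mktuple.
transitivity (P1 [set w | forall i, (i < n)%N -> B' i (U1 i w)]).
  by congr (P1 _); apply/seteqP; split => w /= /(BE _ (fun w i => U1 i w)).
transitivity (P2 [set w | forall i, (i < n)%N -> B' i (U2 i w)]); last first.
  by congr (P2 _); apply/seteqP; split => w /= /(BE _ (fun w i => U2 i w)).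
rewrite !indep_family_prefix//; apply: eq_bigr => i _.
exact: uniform_cube_law.
Qed.

(** The longest edge is a measurable function of the prefix, whose law is the same on every
    probability space; this is what makes the limit law universal. *)
Lemma iid_expectation_ong (d1 d2 : measure_display) (T1 : measurableType d1)
    (T2 : measurableType d2) (P1 : probability T1 R) (P2 : probability T2 R)
    (U1 : nat -> {RV P1 >-> d.-tuple R}) (U2 : nat -> {RV P2 >-> d.-tuple R})
    (f : R -> R) n :
  iid_uniform_cube U1 -> iid_uniform_cube U2 ->
  continuous f -> (exists C, forall x, `|f x| <= C) ->
  'E_P1[f \o (fun w => ong_max (mkseq (fun i => U1 i w) n))]%E =
  'E_P2[f \o (fun w => ong_max (mkseq (fun i => U2 i w) n))]%E.
Proof.
move=> iid1 iid2 cf [C fC].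
pose V1 : {mfun T1 >-> n.-tuple (d.-tuple R)} := HB.pack (fun w => [tuple U1 i w | i < n])
  (isMeasurableFun.Build _ _ _ _ _ (measurable_prefix U1 (n := n))).
pose V2 : {mfun T2 >-> n.-tuple (d.-tuple R)} := HB.pack (fun w => [tuple U2 i w | i < n])
  (isMeasurableFun.Build _ _ _ _ _ (measurable_prefix U2 (n := n))).
pose g (t : n.-tuple (d.-tuple R)) : R := f (ong_max (mkseq (nth origin t) n)).
have gE (x : nat -> d.-tuple R) : g [tuple x i | i < n] = f (ong_max (mkseq x n)).
  congr (f (ong_max _)); apply/eq_in_map => i; rewrite mem_iota => /= ilt.
  have := tnth_nth origin [tuple x i | i < n] (Ordinal ilt).
  by rewrite tnth_mktuple => /= ->.
transitivity ('E_P1[g \o V1])%E; first by congr expectation; apply/funext => w; exact: esym (gE _).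
transitivity ('E_P2[g \o V2])%E; last by congr expectation; apply/funext => w; exact: gE.
apply: expectation_eq_law; last exact: iid_prefix_law.
  apply: (measurableT_comp (continuous_measurable_fun cf)).
  apply: (@measurable_ong_max _ _ _ _ (fun i (t : n.-tuple (d.-tuple R)) => nth origin t i)) => i.
  have [ilt|ilt] := ltnP i n.
    apply: eq_measurable_fun (measurable_tnth (Ordinal ilt)) => t _.
    exact: tnth_nth.
  by under eq_fun do rewrite nth_default ?size_tuple//; exact: measurable_cst.
by exists C => t; exact: fC.
Qed.

End iid_law.

(** * Growth of the Poisson process and random indices *)

Section poisson.
Context (R : realType) (dT : measure_display) (T : measurableType dT).
Variables (P : probability T R).

(** The term of order [j.+1] of the exponential series bounds [expR x] from below, one power of [x]
    more than the numerator of the mass function. *)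
Lemma poisson_pmf_le (x : R) j : 0 < x -> poisson_pmf x j <= j.+1%:R / x.
Proof.
move=> x0; rewrite /poisson_pmf x0 expRN ler_pdivrMr ?expR_gt0//.
have h : x ^+ j.+1 / j.+1`!%:R <= expR x.
  by have := expR_ge1Dxn j (ltW x0); lra.
have j1 : 0 < j.+1%:R / x :> R by rewrite divr_gt0.
apply: le_trans (ler_wpM2l (ltW j1) h).
rewrite exprS factS natrM.
have f0 : j`!%:R != 0 :> R by rewrite pnatr_eq0 -lt0n fact_gt0.
have s0 : j.+1%:R != 0 :> R by rewrite pnatr_eq0.
rewrite le_eqVlt; apply/orP; left; apply/eqP; field.
by rewrite f0 nat1r s0 gt_eqF.
Qed.

(** For fixed [k], the event that the process stays below [k] at all integer times has probability
    at most a constant over [n], for every [n], so it is null. Elsewhere monotonicity keeps the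
    process at or above [k] once it gets there. *)
Lemma poisson_process_infty (N : R -> {RV P >-> nat}) :
  unit_poisson_process N ->
  \forall w \ae P, forall k, exists n0, forall n, (n0 <= n)%N -> (k <= N n%:R w)%N.
Proof.
move=> [N0 ndN _ pmfN _].
apply: ae_foralln => k.
have mN n (A : set nat) : measurable (N n%:R @^-1` A) by exact: measurable_funPTI.
pose B := \bigcap_n [set w | (N n%:R w < k)%N].
have mB : measurable B by apply: bigcapT_measurable => n; exact: (mN n [set i | (i < k)%N]).
have PB n : (0 < n)%N -> (P B <= ((\sum_(j < k) j.+1%:R) / n%:R)%:E)%E.
  move=> n0.
  apply: (@le_trans _ _ (P (\big[setU/set0]_(j < k) (N n%:R @^-1` [set val j])))).
    apply: le_measure; rewrite ?inE//.
      by apply: bigsetU_measurable => j _; exact: mN.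
    move=> w /(_ n I) /= wk; rewrite -bigcup_seq.
    by exists (Ordinal wk); rewrite //= mem_index_enum.
  have mNj j : (j < k)%N -> measurable (N n%:R @^-1` [set j]) by move=> _; exact: mN.
  apply: le_trans (Boole_inequality P mNj) _.
  rewrite mulr_suml -sumEFin; apply: lee_sum => j _.
  have nR : 0 < n%:R :> R by rewrite ltr0n.
  apply: (@le_trans _ _ (poisson_pmf (n%:R : R) j)%:E); last first.
    by rewrite lee_fin poisson_pmf_le.
  (* [pmfN] concerns increments, so the value at time [n] is read as the increment from time 0. *)
  rewrite -[X in poisson_pmf X](subr0 n%:R) -(pmfN _ _ _ (lexx 0) nR).
  rewrite le_eqVlt; apply/orP; left; apply/eqP; congr (P _).
  by apply/seteqP; split => w /=; rewrite N0 subn0.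
have PB0 : P B = 0%E.
  apply/eqP; rewrite eq_le measure_ge0 andbT leNgt; apply/negP => Bgt0.
  have fB : P B \is a fin_num by exact: fin_num_measure.
  rewrite -(fineK fB) lte_fin in Bgt0.
  (* If [P B] were positive, this [n] would make the bound [PB] smaller than [P B]. *)
  pose n := (Num.truncn ((\sum_(j < k) j.+1%:R) / fine (P B))).+1.
  have := PB n isT; rewrite -(fineK fB) lee_fin leNgt => /negP; apply.
  rewrite ltr_pdivrMr ?ltr0n// mulrC -ltr_pdivrMr//.
  exact: truncnS_gt.
exists B; split => // w /= h n _ /=; rewrite ltnNge; apply/negP => kN; apply: h.
exists n => m nm; apply: (leq_trans kN); apply: ndN => //.
by rewrite ler_nat.
Qed.

Lemma measurable_fun_random_index (dE : measure_display) (E : measurableType dE)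
    (X : nat -> T -> E) (K : T -> nat) :
  (forall n, measurable_fun setT (X n)) -> measurable_fun setT K ->
  measurable_fun setT (fun w => X (K w) w).
Proof.
move=> mX mK _ A mA; rewrite setTI.
rewrite (_ : _ @^-1` _ = \bigcup_n ((K @^-1` [set n]) `&` (X n @^-1` A))).
  apply: bigcupT_measurable => n; apply: measurableI.
    by rewrite -[X in measurable X]setTI; exact: mK.
  by rewrite -[X in measurable X]setTI; exact: mX.
apply/seteqP; split => w /=; first by move=> Aw; exists (K w).
by move=> [n _ [/= ->]].
Qed.

End poisson.

(** * The pathwise limit of the longest edge *)

Section ong_limit.
Context (R : realType) (d : nat) (dT : measure_display) (T : measurableType dT).
Variables (P : probability T R) (x : nat -> T -> d.-tuple R).
Hypothesis mx : forall i, measurable_fun setT (x i).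

(* [Num.sqrt d%:R] is the diameter of the unit cube. *)
Definition ong_lim : T -> R :=
  cap_lim (Num.sqrt d%:R) (fun n w => ong_max (mkseq (x ^~ w) n)).

Let O n w := ong_max (mkseq (x ^~ w) n).

Lemma measurable_ong_lim : measurable_fun setT ong_lim.
Proof.
apply: measurable_cap_lim => [n|w]; first exact: measurable_ong_max.
exact: ong_max_mkseq_nd.
Qed.

Hypothesis cube : forall i, \forall w \ae P, forall k, 0 <= tnth (x i w) k <= 1.

Lemma ong_le_diam : \forall w \ae P, forall n, O n w <= Num.sqrt d%:R.
Proof.
apply: filterS (ae_foralln cube) => w h n; apply: ong_max_cube => _ /mapP[i _ ->] k.
exact: h.
Qed.

Lemma ong_expectation_cvg (K : nat -> T -> nat) (f : R -> R) :
  (forall n, measurable_fun setT (K n)) ->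
  (\forall w \ae P, forall k, exists n0, forall n, (n0 <= n)%N -> (k <= K n w)%N) ->
  continuous f -> (exists C, forall y, `|f y| <= C) ->
  'E_P[f \o (fun w => ong_max (mkseq (x ^~ w) (K n w)))]%E @[n --> \oo] -->
  'E_P[f \o ong_lim]%E.
Proof.
move=> mK Kinf cf bf.
apply: (@expectation_cvg_ae _ _ _ _ (fun n w => ong_max (mkseq (x ^~ w) (K n w)))) => //.
- by move=> n; apply: (measurable_fun_random_index (X := O)) => // m; exact: measurable_ong_max.
- exact: measurable_ong_lim.
- apply: cap_lim_cvg_ae => //; first by move=> w; exact: ong_max_mkseq_nd.
  exact: ong_le_diam.
Qed.

Lemma ong_expectation_cvg_nat (f : R -> R) :
  continuous f -> (exists C, forall y, `|f y| <= C) ->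
  'E_P[f \o (fun w => ong_max (mkseq (x ^~ w) n))]%E @[n --> \oo] -->
  'E_P[f \o ong_lim]%E.
Proof.
move=> cf bf; apply: (@ong_expectation_cvg (fun n _ => n)) => //.
by apply: aeW => w k; exists k.
Qed.

Lemma ong_cdf_cvg y : y < Num.sqrt d%:R ->
  P [set w | ong_max (mkseq (x ^~ w) n) <= y] @[n --> \oo] -->
  P [set w | ong_lim w <= y].
Proof.
move=> yd; apply: cap_lim_leE => // [n|w]; first exact: measurable_ong_max.
exact: ong_max_mkseq_nd.
Qed.

End ong_limit.

(** * The max-Dickman law *)

Section unif01_integral.
Variable R : realType.

Lemma unif01_ae : \forall u \ae @unif01 R, 0 < u < 1.
Proof.
exists (~` `]0, 1[%classic); split.
- exact: measurableC.
- suff h : unif01 R `]0, 1[%classic = 1%E.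
    by rewrite [LHS]probability_setC// [X in (1 - X)%E]h subee.
  rewrite unif01_lebesgue// (_ : `]0, 1[ `&` `[0, 1] = `]0, 1[ :> set R)%classic.
    by rewrite lebesgue_measure_itv/= lte_fin ltr01 sube0.
  by apply/setIidPl/subitvP; rewrite subitvE !bnd_simp.
- by move=> u /=; apply: contra_not; rewrite in_itv.
Qed.

Lemma unif01_itvNyo (x : R) : 0 <= x <= 1 -> unif01 R `]-oo, x[%classic = x%:E.
Proof.
move=> /andP[x0 x1]; rewrite unif01_lebesgue//.
rewrite (_ : `]-oo, x[ `&` `[0, 1] = `[0, x[ :> set R)%classic.
  rewrite lebesgue_measure_itv/= lte_fin; case: ltgtP x0 => // [_|<-] _.
    by rewrite sube0.
  by [].
apply/seteqP; split => v /=; rewrite !in_itv/=.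
  by move=> [-> /andP[->]].
by move=> /andP[v0 vx]; rewrite vx v0/=; split => //; apply: ltW; exact: lt_le_trans vx x1.
Qed.

Lemma unif01_itvoy (x : R) : 0 <= x <= 1 -> unif01 R `]x, +oo[%classic = (1 - x)%:E.
Proof.
move=> /andP[x0 x1]; rewrite unif01_lebesgue//.
rewrite (_ : `]x, +oo[ `&` `[0, 1] = `]x, 1] :> set R)%classic.
  rewrite lebesgue_measure_itv/= lte_fin; case: ltgtP x1 => // -> _.
  by rewrite subrr.
apply/seteqP; split => v /=; rewrite !in_itv/= ?andbT.
  by move=> [-> /andP[_ ->]].
by move=> /andP[xv v1]; rewrite xv v1 andbT; split => //; apply: ltW; exact: le_lt_trans xv.
Qed.

Lemma unif01_itvcc (a b : R) : 0 <= a -> a <= b -> b <= 1 ->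
  unif01 R `[a, b]%classic = (b - a)%:E.
Proof.
move=> a0 ab b1; rewrite unif01_lebesgue//.
rewrite (_ : `[a, b] `&` `[0, 1] = `[a, b] :> set R)%classic.
  rewrite lebesgue_measure_itv/= lte_fin; case: ltgtP ab => // -> _.
  by rewrite subrr.
by apply/setIidPl/subitvP; rewrite subitvE !bnd_simp a0.
Qed.

(** Integral form of [unif01_affine]; since [f] vanishes up to [b], the right-hand integral only
    sees []b, +oo[]. *)
Lemma integral_unif01_affine (b : R) (f : R -> \bar R) : 0 <= b <= 1 ->
  measurable_fun setT f -> (forall v, 0 <= f v)%E -> (forall v, v <= b -> f v = 0%E) ->
  ((1 - b)%:E * \int[unif01 R]_u f (1 - (1 - b) * u)%R = \int[unif01 R]_v f v)%E.
Proof.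
move=> b01 mf f0 fb; have /andP[b0 b1] := b01.
have mT : measurable_fun setT (fun u : R => 1 - (1 - b) * u).
  by apply: measurable_funB => //; apply: measurable_funM.
pose Tm : {mfun R >-> R} := HB.pack (fun u : R => 1 - (1 - b) * u)
  (isMeasurableFun.Build _ _ _ _ _ mT).
have b1' : 0 <= 1 - b by rewrite subr_ge0.
pose c : {nonneg R} := NngNum b1'.
transitivity (\int[mscale c (distribution (unif01 R) Tm)]_v f v)%E.
  rewrite ge0_integral_mscale//; congr (_ * _)%E.
  by rewrite (@ge0_integral_distribution _ _ _ _ _ (unif01 R) Tm).
have fD : f = f \_ `]b, +oo[%classic.
  apply/funext => v; rewrite patchE; case: ifPn => //.
  by rewrite notin_setE/= in_itv/= andbT => /negP; rewrite -leNgt => /fb.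
rewrite {1 2}fD -!integral_mkcond.
apply: eq_measure_integral => A mA Ab.
transitivity (unif01 R (A `&` `]b, +oo[%classic)); first exact: unif01_affine.
by congr (unif01 R _); exact/setIidPl.
Qed.

Lemma integral_unif01_reflect (f : R -> \bar R) :
  measurable_fun setT f -> (forall v, 0 <= f v)%E -> (forall v, v <= 0 -> f v = 0%E) ->
  (\int[unif01 R]_u f (1 - u)%R = \int[unif01 R]_v f v)%E.
Proof.
move=> mf f0 fb; rewrite -[RHS](integral_unif01_affine (b := 0)) ?lexx ?ler01//.
by rewrite subr0 mul1e; under [RHS]eq_integral do rewrite mul1r.
Qed.

End unif01_integral.

Section dickman.
Variable R : realType.
Local Notation mu := (unif01 R).

(** The fixed-point equation of [max_dickman] with the independent uniform variable integrated out:
    a condition on the law alone, whatever space carries the variable. *)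
Definition dickman_law (nu : probability R R) : Prop :=
  forall A, measurable A ->
    nu A = (\int[mu]_u nu [set m | A (Num.max (1 - u) (u * m))%R])%E.

Lemma max_dickman_law (dT : measure_display) (T : measurableType dT)
    (P : probability T R) (M : {RV P >-> R}) :
  max_dickman M -> dickman_law (distribution P M).
Proof.
move=> [d' [T' [P' [U [M' [uU ind [_ _ eqM'] [_ _ eqM]]]]]]] A mA.
have mg : measurable_fun setT (fun z : R * R => Num.max (1 - z.1) (z.1 * z.2)).
  by apply: measurable_maxr; [exact: measurable_funB|exact: measurable_funM].
pose D := [set z : R * R | A (Num.max (1 - z.1) (z.1 * z.2))].
have mD : measurable D.
  by rewrite -[D]setTI; exact: mg.
rewrite [LHS](eqM A mA) -[LHS]/(P' [set w | D (U w, M' w)]).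
rewrite (prob_indep_pair (m := distribution P M))//; last first.
  move=> B C mB mC; rewrite ind//.
  - by congr (_ * _)%E; exact: eqM'.
  - by exists B => //; rewrite setTI.
  - by exists C => //; rewrite setTI.
rewrite -(@ge0_integral_distribution _ _ _ _ _ P' U
  (fun u => distribution P M [set m | D (u, m)]))//; last first.
  rewrite (_ : (fun _ => _) = distribution P M \o xsection D).
    exact: measurable_fun_xsection.
  apply/funext => u /=; congr (P _); apply/seteqP; split => w; rewrite /xsection/= inE//.
by apply: eq_measure_integral => B mB _; exact: uU.
Qed.

End dickman.

(** * The support of a max-Dickman law *)

Section dickman_properties.
Variables (R : realType) (nu : probability R R).
Local Notation mu := (unif01 R).

Lemma measurable_fun_section (D : set (R * R)) : measurable D ->
  measurable_fun setT (fun u => nu [set m | D (u, m)]).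
Proof.
move=> mD; rewrite (_ : (fun _ => _) = nu \o xsection D).
  exact: measurable_fun_xsection.
apply/funext => u /=; congr (nu _); apply/seteqP; split => m; rewrite /xsection/= inE//.
Qed.

Lemma measurable_section (D : set (R * R)) u : measurable D ->
  measurable [set m | D (u, m)].
Proof.
move=> mD; rewrite (_ : [set m | _] = xsection D u); first exact: measurable_xsection.
by apply/seteqP; split => m; rewrite /xsection/= inE.
Qed.

Let measurable_dickman_map :
  measurable_fun setT (fun z : R * R => Num.max (1 - z.1) (z.1 * z.2)).
Proof. by apply: measurable_maxr; [exact: measurable_funB|exact: measurable_funM]. Qed.

Let measurable_dickman_pre (A : set R) : measurable A ->
  measurable [set z : R * R | A (Num.max (1 - z.1) (z.1 * z.2))].
Proof. by move=> mA; rewrite -[X in measurable X]setTI; exact: measurable_dickman_map. Qed.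

Hypothesis nuD : dickman_law nu.

(** The maximum is at least [1 - u], positive for almost every [u]. *)
Lemma dickman_law_le0 : nu `]-oo, 0]%classic = 0%E.
Proof.
rewrite nuD// (ae_eq_integral (cst 0%E))//.
- by rewrite integral0.
- exact: (measurable_fun_section (measurable_dickman_pre (measurable_itv _))).
- apply: filterS (unif01_ae R) => u /andP[u0 u1] _.
  rewrite (_ : [set m | _] = set0) ?measure0//.
  apply/seteqP; split => // m /=; rewrite in_itv/= ge_max => /andP[+ _].
  by rewrite leNgt subr_gt0 u1.
Qed.

(** As [1 - u] stays below 1, the maximum exceeds [t] only if [u * m] does. This forces [m > 2 * t]
    when [u < 1/2], and [m > t] in any case. Averaging over both halves gives [a <= b / 2 + a / 2],
    that is [a <= b]. *)
Lemma dickman_law_gt_double t : 1 <= t ->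
  (nu `]t%R, +oo[%classic <= nu `](2 * t)%R, +oo[%classic)%E.
Proof.
move=> t1; set a := nu `]t, +oo[%classic; set b := nu `](2 * t), +oo[%classic.
have fa : a \is a fin_num by exact: fin_num_measure.
have fb : b \is a fin_num by exact: fin_num_measure.
have a0 : (0 <= a)%E by exact: measure_ge0.
have b0 : (0 <= b)%E by exact: measure_ge0.
pose A : set R := `]-oo, 2^-1[%classic.
have muA : mu A = (2^-1)%:E by apply: unif01_itvNyo; apply/andP; split; lra.
have mA : measurable A by exact: measurable_itv.
have muAC : mu (~` A) = (2^-1)%:E.
  by rewrite [LHS](probability_setC _ mA) [X in (1 - X)%E]muA -EFinB; congr (_%:E); lra.
suff : (a <= b * (2^-1)%:E + a * (2^-1)%:E)%E.
  by rewrite -(fineK fa) -(fineK fb) -!EFinM -EFinD !lee_fin; lra.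
have mAf : measurable_fun setT (fun u : R => (\1_A u)%:E : \bar R).
  by apply/measurable_EFinP; exact: measurable_indic.
have mACf : measurable_fun setT (fun u : R => (\1_(~` A) u)%:E : \bar R).
  by apply/measurable_EFinP; apply: measurable_indic; exact: measurableC.
have -> : (b * (2^-1)%:E + a * (2^-1)%:E =
    \int[mu]_u (b * (\1_A u)%:E + a * (\1_(~` A) u)%:E))%E.
  rewrite ge0_integralD//; last 4 first.
  - by move=> u _; rewrite mule_ge0// lee_fin.
  - exact: measurable_funeM.
  - by move=> u _; rewrite mule_ge0// lee_fin.
  - exact: measurable_funeM.
  rewrite !ge0_integralZl//.
  rewrite (integral_indic mu measurableT mA).
  rewrite (integral_indic mu measurableT (measurableC mA)) !setIT.
  by congr (_ * _ + _ * _)%E; apply/esym.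
rewrite {1}/a nuD//; apply: ae_ge0_le_integral => //.
- exact: (measurable_fun_section (measurable_dickman_pre (measurable_itv _))).
- by move=> u _; rewrite adde_ge0// mule_ge0// lee_fin.
- by apply: emeasurable_funD; exact: measurable_funeM.
- apply: filterS (unif01_ae R) => u /andP[u0 u1] _.
  have uAE : (u \in A) = (u < 2^-1) by apply/idP/idP; rewrite inE /A /= in_itv.
  rewrite !indicE in_setC uAE; have [uA|uA] := ltP u 2^-1.
    rewrite mule1 mule0 adde0; apply: le_measure; rewrite ?inE//.
      exact: (measurable_section _ (measurable_dickman_pre (measurable_itv _))).
    by move=> m /=; rewrite !in_itv/= !andbT lt_max => /orP[|h]; [lra|nra].
  rewrite mule1 mule0 add0e; apply: le_measure; rewrite ?inE//.
    exact: (measurable_section _ (measurable_dickman_pre (measurable_itv _))).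
  by move=> m /=; rewrite !in_itv/= !andbT lt_max => /orP[|h]; [lra|nra].
Qed.

(** By repeated doubling this mass is at most that beyond [2 ^+ n], which tends to 0. *)
Lemma dickman_law_gt1 : nu `]1, +oo[%classic = 0%E.
Proof.
apply/eqP; rewrite eq_le measure_ge0 andbT.
pose F n := `](2 ^+ n), +oo[%classic : set R.
have mF n : measurable (F n) by exact: measurable_itv.
have le1F n : (nu `]1%R, +oo[%classic <= nu (F n))%E.
  elim: n => [|n ih]; first by rewrite /F expr0.
  apply: (le_trans ih); rewrite /F exprS; apply: dickman_law_gt_double.
  by rewrite exprn_ege1// ler1n.
have F0 : \bigcap_n F n = set0.
  apply/seteqP; split => // x Fx.
  have := Fx (Num.truncn x).+1 I; rewrite /F/= in_itv/= andbT ltNge => /negP; apply.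
  apply: (@le_trans _ _ (Num.truncn x).+1%:R); first exact/ltW/truncnS_gt.
  by rewrite -natrX ler_nat ltnW// ltn_expl.
have cF : nu (F n) @[n --> \oo] --> 0%E.
  rewrite -(measure0 nu) -F0; apply: nonincreasing_cvg_mu => //.
  - by rewrite -ge0_fin_numE// fin_num_measure.
  - by rewrite F0.
  - move=> m n mn; apply/subsetPset/subset_itvr; rewrite bnd_simp.
    by rewrite ler_weXn2l// ler1n.
by apply: (cvge_ge _ cF); apply: nearW => n; exact: le1F.
Qed.

End dickman_properties.

(* In the limit, the probability that no edge longer than [y] is created to the
   right of the current maximum [x]. *)
Definition right_cdf (R : realType) (nu : probability R R) (y x : R) : \bar R :=
  nu [set m | (1 - x) * m <= y].

(** * The integral equation and the harmonic function *)

Section right_cdf.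
Variables (R : realType) (nu : probability R R) (y : R).
Local Notation mu := (unif01 R).
Local Notation h := (right_cdf nu y).
Hypotheses (nuD : dickman_law nu) (y0 : 0 < y) (y1 : y < 1).

Let measurable_scaled : measurable [set z : R * R | (1 - z.1) * z.2 <= y].
Proof.
rewrite -[X in measurable X]setTI.
rewrite -[X in _ `&` X]/((fun z : R * R => (1 - z.1) * z.2) @^-1` [set t | t <= y]).
suff mf : measurable_fun setT (fun z : R * R => (1 - z.1) * z.2).
  by apply: mf => //; rewrite -set_itvNyc.
by apply: measurable_funM => //; apply: measurable_funB.
Qed.

Lemma right_cdf_ge0 x : (0 <= h x)%E.
Proof. exact: measure_ge0. Qed.

Lemma right_cdf_le1 x : (h x <= 1)%E.
Proof.
by apply: probability_le1; exact: (measurable_section x measurable_scaled).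
Qed.

Lemma right_cdf_fin_num x : h x \is a fin_num.
Proof.
by apply: fin_num_measure; exact: (measurable_section x measurable_scaled).
Qed.

Lemma measurable_right_cdf : measurable_fun setT h.
Proof. exact: (measurable_fun_section nu measurable_scaled). Qed.

(** The room [1 - x] to the right is at most [y], and [nu] gives no mass to [m > 1]. *)
Lemma right_cdf1 x : 1 - y <= x -> x <= 1 -> h x = 1%E.
Proof.
move=> yx x1; apply/eqP; rewrite eq_le right_cdf_le1/=.
have <- : nu `]-oo, 1%R]%classic = 1%E.
  rewrite -[X in nu X]setCK setCitvl [LHS]probability_setC//.
  by rewrite [X in (1 - X)%E](dickman_law_gt1 nuD) sube0.
apply: le_measure; rewrite ?inE//; first exact: (measurable_section x measurable_scaled).
by move=> m /=; rewrite in_itv/= => m1; nra.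
Qed.

(** Chance of success when the next record above [b] falls at [v]; a jump longer than [y] is
    fatal. *)
Definition right_step (b v : R) : \bar R := if b < v <= b + y then h v else 0%E.

Lemma right_step_ge0 b v : (0 <= right_step b v)%E.
Proof. by rewrite /right_step; case: ifP => // _; exact: right_cdf_ge0. Qed.

Lemma measurable_right_step b : measurable_fun setT (right_step b).
Proof.
apply: measurable_fun_ifT => //.
  apply: measurable_and; [exact: measurable_fun_ltr|exact: measurable_fun_ler].
exact: measurable_right_cdf.
Qed.

(* First-step equation: condition on the relative position of the next
   record, which is uniform. *)
Lemma integral_right_step b : 0 <= b <= 1 ->
  (\int[mu]_v right_step b v = (1 - b)%:E * h b)%E.
Proof.
move=> /andP[b0]; rewrite le_eqVlt => /predU1P[->|b1].
  rewrite subrr mul0e -[RHS](integral0 mu setT).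
  apply: ae_eq_integral => //; first exact: measurable_right_step.
  apply: filterS (unif01_ae R) => v /andP[v0 v1] _.
  by rewrite /right_step ltNge (ltW v1).
rewrite -[LHS](integral_unif01_affine (b := b)); last first.
- by move=> v vb; rewrite /right_step ltNge vb.
- exact: right_step_ge0.
- exact: measurable_right_step.
- by rewrite b0 ltW.
congr (_ * _)%E; rewrite /right_cdf.
pose A := [set m | (1 - b) * m <= y].
have mA : measurable A by exact: (measurable_section b measurable_scaled).
rewrite [RHS](nuD mA); apply: ae_eq_integral => //.
- have mT : measurable_fun setT (fun u : R => 1 - (1 - b) * u).
    by apply: measurable_funB => //; apply: measurable_funM.
  exact: (measurableT_comp (measurable_right_step b) mT).
- apply: (measurable_fun_section nu (D := [set z | A (Num.max (1 - z.1) (z.1 * z.2))])).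
  rewrite -[X in measurable X]setTI.
  suff mf : measurable_fun setT (fun z : R * R => Num.max (1 - z.1) (z.1 * z.2)) by exact: mf.
  by apply: measurable_maxr; [exact: measurable_funB|exact: measurable_funM].
apply: filterS (unif01_ae R) => u /andP[u0 u1] _.
(* With [v = 1 - (1 - b) * u], the first argument of the maximum yields the bound [v <= b + y] on
   the jump. The second yields the condition that defines [right_cdf] at [v], because
   [1 - v = (1 - b) * u]. *)
have AE m : A (Num.max (1 - u) (u * m)) <->
    ((1 - (1 - b) * u) <= b + y) && ((1 - (1 - (1 - b) * u)) * m <= y).
  rewrite /A/= maxr_pMr ?subr_ge0 ?(ltW b1)// ge_max.
  rewrite (_ : (1 - b) * (1 - u) = (1 - (1 - b) * u) - b); last by ring.
  rewrite (_ : (1 - b) * (u * m) = (1 - (1 - (1 - b) * u)) * m); last by ring.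
  by rewrite lerBlDl.
rewrite /right_step (_ : b < _); last nra.
case: ifPn => /= hb.
  congr (nu _); apply/seteqP; split => m /=; rewrite /right_cdf.
    by move=> hm; apply/AE; rewrite hb.
  by move=> /AE /andP[].
rewrite (_ : [set m | _] = set0) ?measure0//.
by apply/seteqP; split => // m /= /AE; rewrite (negbTE hb).
Qed.

Lemma integral_left_step c : 0 <= c <= 1 ->
  (\int[mu]_v right_step c (1 - v)%R = (1 - c)%:E * h c)%E.
Proof.
move=> c01; rewrite -integral_right_step// -[RHS]integral_unif01_reflect//.
- exact: measurable_right_step.
- exact: right_step_ge0.
- by move=> v v0; rewrite /right_step ltNge (le_trans v0)//; case/andP: c01.
Qed.

(* [right_cdf b * right_cdf (1 - a)] is harmonic for the range [[a, b]] of the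
   points, killed when a long edge appears. *)
Lemma right_cdf_harmonic (a b : R) : 0 <= a -> a <= b -> b <= 1 ->
  (\int[mu]_v (if (a - y <= v <= b + y)%R
     then h (Num.max b v)%R * h (1 - Num.min a v)%R else 0) = h b * h (1 - a)%R)%E.
Proof.
move=> a0 ab b1.
have y0R : (0 : R) < y := y0.
have ca : 0 <= 1 - a <= 1 by apply/andP; split; lra.
have cb : 0 <= b <= 1 by rewrite b1 (le_trans a0).
pose I : set R := `[a, b]%classic.
have mI : measurable I by exact: measurable_itv.
(* Three disjoint cases: a new maximum, a new minimum (a new maximum after reflection), or a point
   inside the range, which changes nothing. *)
transitivity (\int[mu]_v (h (1 - a)%R * right_step b v +
   (h b * right_step (1 - a) (1 - v)%R + (h b * h (1 - a)%R) * (\1_I v)%:E)))%E.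
  apply: eq_integral => v _; rewrite /right_step indicE.
  have -> : (v \in I) = (a <= v <= b) by apply/idP/idP; rewrite inE /I /= in_itv.
  have [av|va] := leP a v.
    have -> : (1 - a < 1 - v) = false by apply/negbTE; rewrite -leNgt; lra.
    rewrite /= mule0 add0e.
    have -> /= : a - y <= v by lra.
    have [vb|bv] := leP v b.
      by rewrite /= (_ : v <= b + y) ?mule1 ?mule0 ?add0e//; lra.
    by rewrite /= mule0 adde0; case: ifP; rewrite ?mule0// muleC.
  have vb : v < b by exact: lt_le_trans ab.
  have -> : (b < v) = false by apply/negbTE; rewrite -leNgt ltW.
  rewrite /= mule0 add0e mule0 adde0.
  have -> /= : 1 - a < 1 - v by lra.
  have -> : (1 - v <= 1 - a + y) = (a - y <= v) by apply/idP/idP => ?; lra.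
  have -> : (v <= b + y) by lra.
  rewrite andbT (max_l (ltW vb)).
  by case: ifP; rewrite ?mule0.
have m1 := measurable_right_step b.
have m2 : measurable_fun setT (fun v : R => right_step (1 - a) (1 - v)%R).
  apply: (measurableT_comp (measurable_right_step (1 - a))).
  exact: measurable_funB.
have m3 : measurable_fun setT (fun v : R => (\1_I v)%:E : \bar R).
  by apply/measurable_EFinP; exact: measurable_indic.
have hb0 := right_cdf_ge0 b; have ha0 := right_cdf_ge0 (1 - a).
have hab0 : (0 <= h b * h (1 - a)%R)%E by rewrite mule_ge0.
have p1 v : (0 <= h (1 - a)%R * right_step b v)%E by rewrite mule_ge0// right_step_ge0.
have p2 v : (0 <= h b * right_step (1 - a) (1 - v)%R)%E.
  by rewrite mule_ge0// right_step_ge0.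
have p3 v : (0 <= h b * h (1 - a)%R * (\1_I v)%:E)%E.
  by rewrite mule_ge0// lee_fin.
have q1 : measurable_fun setT (fun v => h (1 - a)%R * right_step b v)%E.
  exact: measurable_funeM.
have q2 : measurable_fun setT
    (fun v : R => h b * right_step (1 - a) (1 - v)%R)%E.
  exact: measurable_funeM.
have q3 : measurable_fun setT
    (fun v : R => h b * h (1 - a)%R * (\1_I v)%:E)%E.
  exact: measurable_funeM.
rewrite ge0_integralD//; last 2 first.
- by move=> v _; rewrite adde_ge0.
- exact: emeasurable_funD.
rewrite ge0_integralD// !ge0_integralZl//; last 2 first.
- by move=> v _; exact: right_step_ge0.
- by move=> v _; exact: right_step_ge0.
have IE : (\int[mu]_v (\1_I v)%:E = (b - a)%:E)%E.
  by rewrite (integral_indic mu measurableT mI) setIT; exact: unif01_itvcc.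
(* The three cases contribute [h b * h (1 - a)] with weights [1 - b], [a] and [b - a], whose sum is
   1. *)
rewrite integral_right_step// integral_left_step// IE.
rewrite -(fineK (right_cdf_fin_num b)) -(fineK (right_cdf_fin_num (1 - a))).
rewrite -!EFinM -!EFinD; congr (_%:E); ring.
Qed.

End right_cdf.

(** * Uniqueness of the solution of the integral equation *)

Section uniqueness.
Variables (R : realType) (nu1 nu2 : probability R R) (y : R).
Local Notation mu := (unif01 R).
Hypotheses (D1 : dickman_law nu1) (D2 : dickman_law nu2) (y0 : 0 < y) (y1 : y < 1).

(* A record beyond [1 - y] ends the comparison, as [right_cdf] is 1 there; this
   loss of mass is the factor [1 - y]. *)
Lemma right_cdf_contraction n x : 0 <= x <= 1 ->
  (right_cdf nu1 y x <= right_cdf nu2 y x + ((1 - y) ^+ n)%:E)%E.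
Proof.
elim: n x => [|n ih] x.
  move=> _; rewrite expr0; apply: (le_trans (right_cdf_le1 _ _ _)).
  by rewrite leeDr// right_cdf_ge0.
move=> /andP[x0 x1].
have c0 : 0 <= (1 - y) ^+ n by rewrite exprn_ge0// subr_ge0 ltW.
have y0R : (0 : R) < y := y0.
have y1R : y < 1 :> R := y1.
have [yx|xy] := leP (1 - y) x.
  rewrite !right_cdf1// leeDl// lee_fin exprn_ge0// subr_ge0 ltW//.
have x1' : (0 < (1 - x)%:E :> \bar R)%E by rewrite lte_fin; lra.
rewrite -(lee_pmul2l _ x1')//.
have x01 : 0 <= x <= 1 by rewrite x0.
rewrite -integral_right_step//.
(* The induction hypothesis is spent on records in [J] only, so the error term is integrated over a
   length [1 - y - x]. *)
pose J : set R := `[x, (1 - y)%R]%classic.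
have mJ : measurable J by exact: measurable_itv.
have mf : measurable_fun setT (fun v : R => ((1 - y) ^+ n)%:E * (\1_J v)%:E : \bar R)%E.
  by apply: measurable_funeM; apply/measurable_EFinP; exact: measurable_indic.
have pf v : (0 <= ((1 - y) ^+ n)%:E * (\1_J v)%:E)%E by rewrite mule_ge0// lee_fin.
have mr2 := measurable_right_step nu2 y x.
have pr2 := right_step_ge0 nu2 y x.
apply: (@le_trans _ _ (\int[mu]_v (right_step nu2 y x v + ((1 - y) ^+ n)%:E * (\1_J v)%:E))%E).
  apply: ae_ge0_le_integral => //.
  - by move=> v _; exact: right_step_ge0.
  - exact: measurable_right_step.
  - by move=> v _; rewrite adde_ge0.
  - exact: emeasurable_funD.
  - apply: filterS (unif01_ae R) => v /andP[v0 v1] _.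
    rewrite /right_step; case: ifPn => [/andP[xv vxy]|_]; last by rewrite add0e.
    have [yv|vy] := leP (1 - y) v.
      by rewrite !right_cdf1 ?(ltW v1)// leeDl.
    rewrite indicE (_ : v \in J); last by rewrite inE /J/= in_itv/= !ltW.
    by rewrite mule1 ih// !ltW.
rewrite ge0_integralD// ge0_integralZl//; last first.
  by apply/measurable_EFinP; exact: measurable_indic.
have JE : (\int[mu]_v (\1_J v)%:E = (1 - y - x)%:E)%E.
  by rewrite (integral_indic mu measurableT mJ) setIT; apply: unif01_itvcc => //; lra.
rewrite JE.
rewrite integral_right_step//.
rewrite -(fineK (right_cdf_fin_num nu2 y x)) -!EFinM -!EFinD lee_fin.
(* What remains is [1 - y - x <= (1 - x) * (1 - y)]. *)
rewrite [leRHS]mulrDr lerD2l exprS mulrA [leLHS]mulrC ler_wpM2r//.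
by nra.
Qed.

Lemma right_cdf_le x : 0 <= x <= 1 -> (right_cdf nu1 y x <= right_cdf nu2 y x)%E.
Proof.
move=> x01; apply/lee_addgt0Pr => e e0.
have y0R : (0 : R) < y := y0.
have y1R : y < 1 :> R := y1.
have : (1 - y) ^+ n @[n --> \oo] --> (0 : R).
  by apply: cvg_expr; rewrite ger0_norm; lra.
move=> /cvgrPdist_lt/(_ e e0)[n _ /(_ n (leqnn _))] /=.
rewrite sub0r normrN => hn.
apply: (le_trans (right_cdf_contraction n x01)); rewrite leeD2l// lee_fin.
exact: le_trans (ler_norm _) (ltW hn).
Qed.

End uniqueness.

Lemma right_cdf_unique (R : realType) (nu1 nu2 : probability R R) (y x : R) :
  dickman_law nu1 -> dickman_law nu2 -> 0 < y < 1 -> 0 <= x <= 1 ->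
  right_cdf nu1 y x = right_cdf nu2 y x.
Proof.
move=> D1 D2 /andP[y0 y1] x01.
by apply/eqP; rewrite eq_le !right_cdf_le.
Qed.

(** * The Markov chain of ranges *)

(** For fixed [C] both sides are finite measures in [A], and they agree on boxes. *)
Lemma indep_tuple_box (R : realType) (d d1 d2 : measure_display)
    (T : measurableType d) (E : measurableType d1) (F : measurableType d2) n
    (P : probability T R) (V : {mfun T >-> n.-tuple E}) (Y : {mfun T >-> F})
    (m : probability F R) :
  (forall (B : 'I_n -> set E) C, (forall k, measurable (B k)) -> measurable C ->
    P ([set w | forall k, B k (tnth (V w) k)] `&` Y @^-1` C) =
    (P [set w | forall k, B k (tnth (V w) k)] * m C)%E) ->
  forall A C, measurable A -> measurable C ->
    P (V @^-1` A `&` Y @^-1` C) = (P (V @^-1` A) * m C)%E.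
Proof.
move=> ind A C mA mC.
have mYC : measurable (Y @^-1` C) by exact: measurable_funPTI.
have fC : m C \is a fin_num by exact: fin_num_measure.
pose c : {nonneg R} := NngNum (fine_ge0 (measure_ge0 m C)).
pose m1 := pushforward (mrestr P mYC) V.
pose m2 := mscale c (distribution P V).
have m2E B : m2 B = (P (V @^-1` B) * m C)%E by rewrite /m2 /mscale/= fineK// muleC.
rewrite -m2E.
apply: (finite_measure_eq_box (m1 := m1) (m2 := m2)) => // [|B mB].
  rewrite [ltLHS](_ : _ = P (setT `&` Y @^-1` C)); last by [].
  by rewrite setTI -ge0_fin_numE// fin_num_measure.
exact: etrans (ind B C mB mC) (esym (m2E _)).
Qed.

Section records.
Context (R : realType) (dT : measure_display) (T : measurableType dT).
Implicit Types (X : nat -> T -> R).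

Lemma measurable_run_min X n : (forall i, measurable_fun setT (X i)) ->
  measurable_fun setT (fun w => run_min (X ^~ w) n).
Proof. by move=> mX; elim: n => [|n ih] //=; exact: measurable_minr. Qed.

Lemma measurable_run_max X n : (forall i, measurable_fun setT (X i)) ->
  measurable_fun setT (fun w => run_max (X ^~ w) n).
Proof. by move=> mX; elim: n => [|n ih] //=; exact: measurable_maxr. Qed.

Lemma measurable_short_records X y n : (forall i, measurable_fun setT (X i)) ->
  measurable_fun setT (fun w => short_records y (X ^~ w) n).
Proof.
move=> mX; elim: n => [|n ih] /=; first exact: measurable_cst.
apply: measurable_and => //; apply: measurable_and.
  by apply: measurable_fun_ler => //; apply: measurable_funB => //; exact: measurable_run_min.
by apply: measurable_fun_ler => //; apply: measurable_funD => //; exact: measurable_run_max.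
Qed.

Definition record_state X y n w : bool * (R * R) :=
  (short_records y (X ^~ w) n, (run_min (X ^~ w) n, run_max (X ^~ w) n)).

Lemma measurable_record_state X y n : (forall i, measurable_fun setT (X i)) ->
  measurable_fun setT (record_state X y n).
Proof.
move=> mX; apply: measurable_fun_pair; first exact: measurable_short_records.
by apply: measurable_fun_pair; [exact: measurable_run_min|exact: measurable_run_max].
Qed.

End records.

(** * The martingale of the range killed at the first long edge *)

Section record_martingale.
Context (R : realType) (dT : measure_display) (T : measurableType dT).
Variables (P : probability T R) (X : nat -> {mfun T >-> R}).
Variables (nu : probability R R) (y : R).
Local Notation mu := (unif01 R).
Local Notation h := (right_cdf nu y).
Hypotheses (nuD : dickman_law nu) (y0 : 0 < y) (y1 : y < 1).
Hypothesis X01 : forall i, \forall w \ae P, 0 <= X i w <= 1.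
(** The law of [X 0] is left free: it is uniform for the plain graph and concentrated at 0 for the
    graph started at the origin. *)
Hypothesis Xind : forall n (B : nat -> set R), (forall i, measurable (B i)) ->
  P [set w | forall i, (i <= n.+1)%N -> B i (X i w)] =
  (P [set w | forall i, (i <= n)%N -> B i (X i w)] * mu (B n.+1))%E.

Let S n w := record_state X y n w.

(** The state is a function [g] of the tuple of the first [n.+1] points, and for that tuple
    independence can be checked on boxes. *)
Lemma record_state_indep n (A : set (bool * (R * R))) (C : set R) :
  measurable A -> measurable C ->
  P (S n @^-1` A `&` X n.+1 @^-1` C) = (P (S n @^-1` A) * mu C)%E.
Proof.
move=> mA mC.
pose V : {mfun T >-> n.+1.-tuple R} := HB.pack (fun w => [tuple X i w | i < n.+1])
  (isMeasurableFun.Build _ _ _ _ _ (measurable_prefix X (n := n.+1))).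
pose g := record_state (fun i (t : n.+1.-tuple R) => nth 0 t i) y n.
have mg : measurable_fun setT g.
  apply: measurable_record_state => i; have [ilt|ilt] := ltnP i n.+1.
    apply: eq_measurable_fun (measurable_tnth (Ordinal ilt)) => t _.
    exact: tnth_nth.
  by under eq_fun do rewrite nth_default ?size_tuple//; exact: measurable_cst.
have gV w : S n w = g (V w).
  have e i : (i <= n)%N -> X i w = nth 0 (V w) i.
    move=> ilt; have := tnth_nth 0 (V w) (Ordinal (ilt : (i < n.+1)%N)).
    by rewrite /V/= tnth_mktuple => /= ->.
  rewrite /S /g /record_state (short_records_eq y e).
  by have [-> ->] := run_eq e.
have -> : S n @^-1` A = V @^-1` (g @^-1` A).
  by apply/seteqP; split => w; rewrite /preimage/= gV.
apply: (indep_tuple_box (V := V) (Y := X n.+1)) => //; last first.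
  by rewrite -[X in measurable X]setTI; exact: mg.
move=> B D mB mD.
(* The sides of the box followed by [D], in the format of [Xind]. *)
pose B' i : set R := if insub i is Some k then B k else if i == n.+1 then D else setT.
have mB' i : measurable (B' i) by rewrite /B'; case: insub => //; case: ifP.
have B'n : B' n.+1 = D by rewrite /B' insubF ?ltnn// eqxx.
have BE w : (forall k, B k (tnth (V w) k)) <-> (forall i, (i <= n)%N -> B' i (X i w)).
  split=> [hB i ilt|hB k].
    by have := hB (Ordinal (ilt : (i < n.+1)%N)); rewrite /B' insubT tnth_mktuple.
  by have := hB k (ltn_ord k); rewrite /B' valK tnth_mktuple.
have := Xind n mB'; rewrite B'n.
rewrite (_ : [set w | forall k, B k (tnth (V w) k)] =
   [set w | forall i, (i <= n)%N -> B' i (X i w)]); last first.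
  by apply/seteqP; split => w /= /BE.
move=> <-; congr (P _); apply/seteqP; split => w /=.
  move=> [h1 h2] i; rewrite leq_eqVlt => /predU1P[->|]; last exact: h1.
  by rewrite B'n.
move=> hi; split; last by rewrite -B'n; exact: hi.
by move=> i ilt; apply: hi; exact: leqW.
Qed.

(** The harmonic function of [right_cdf_harmonic], extended by 0 to killed states. *)
Definition record_value (s : bool * (R * R)) : \bar R :=
  if s.1 then (h s.2.2 * h (1 - s.2.1)%R)%E else 0%E.

Definition record_step (s : bool * (R * R)) (v : R) : bool * (R * R) :=
  (s.1 && (s.2.1 - y <= v <= s.2.2 + y), (Num.min s.2.1 v, Num.max s.2.2 v)).

Lemma record_value_ge0 s : (0 <= record_value s)%E.
Proof. by rewrite /record_value; case: ifP => // _; rewrite mule_ge0// right_cdf_ge0. Qed.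

Lemma measurable_record_value : measurable_fun setT record_value.
Proof.
have mh := measurable_right_cdf nu y.
have m1 : measurable_fun setT (fun s : bool * (R * R) => s.2.1).
  exact: (measurableT_comp measurable_fst measurable_snd).
have m2 : measurable_fun setT (fun s : bool * (R * R) => s.2.2).
  exact: (measurableT_comp measurable_snd measurable_snd).
apply: measurable_fun_ifT => //; apply: emeasurable_funM.
  exact: (measurableT_comp mh m2).
by apply: (measurableT_comp mh); exact: measurable_funB.
Qed.

Lemma measurable_record_step :
  measurable_fun setT (fun z : bool * (R * R) * R => record_step z.1 z.2).
Proof.
have m0 : measurable_fun setT (fun z : bool * (R * R) * R => z.1.1).
  exact: (measurableT_comp measurable_fst measurable_fst).
have m12 : measurable_fun setT (fun z : bool * (R * R) * R => z.1.2).
  exact: (measurableT_comp measurable_snd measurable_fst).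
have m1 : measurable_fun setT (fun z : bool * (R * R) * R => z.1.2.1).
  exact: (measurableT_comp measurable_fst m12).
have m2 : measurable_fun setT (fun z : bool * (R * R) * R => z.1.2.2).
  exact: (measurableT_comp measurable_snd m12).
apply: measurable_fun_pair.
  apply: measurable_and => //; apply: measurable_and; apply: measurable_fun_ler => //.
    exact: measurable_funB.
  exact: measurable_funD.
by apply: measurable_fun_pair; [exact: measurable_minr|exact: measurable_maxr].
Qed.

Lemma record_state_itv : \forall w \ae P, forall n,
  [/\ 0 <= (S n w).2.1, (S n w).2.1 <= (S n w).2.2 & (S n w).2.2 <= 1].
Proof.
apply: filterS (ae_foralln X01) => w hw n.
have [h1 h2] := @run_minmax_itv _ (X ^~ w) n (fun i _ => hw i).
by split => //; exact: run_min_le_max.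
Qed.

Lemma measurable_S n : measurable_fun setT (S n).
Proof. exact: measurable_record_state. Qed.

(** Martingale property: integrating out the next point returns the current value by harmonicity,
    and a killed state stays killed. *)
Lemma integral_record_value n :
  (\int[P]_w record_value (S n w) = \int[P]_w (h (X 0%N w) * h (1 - X 0%N w)%R))%E.
Proof.
elim: n => [//|n <-].
pose Sn : {mfun T >-> (bool * (R * R))%type} := HB.pack (S n)
  (isMeasurableFun.Build _ _ _ _ _ (measurable_S n)).
have mf : measurable_fun setT
    (fun z : bool * (R * R) * R => record_value (record_step z.1 z.2)).
  exact: (measurableT_comp measurable_record_value measurable_record_step).
(* By computation, [S n.+1 w] is [record_step (S n w) (X n.+1 w)]. *)
rewrite [LHS](@integral_indep_pair _ _ _ _ _ _ _ P Sn (X n.+1) mu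
    (fun z => record_value (record_step z.1 z.2))) //; last 2 first.
- by move=> B D mB mD; exact: record_state_indep.
- by move=> z; exact: record_value_ge0.
apply: ae_eq_integral => //.
- apply: (measurableT_comp (f := fun s => \int[mu]_v record_value (record_step s v))%E).
    apply: (measurable_fun_fubini_tonelli_F (m2 := mu)
      (fun z : bool * (R * R) * R => record_value (record_step z.1 z.2))) => //.
    by move=> z; exact: record_value_ge0.
  exact: measurable_S.
- exact: (measurableT_comp measurable_record_value (measurable_S n)).
apply: filterS record_state_itv => w /(_ n)[a0 ab b1] _ /=.
rewrite {2}/record_value; case: ifPn => ok; last first.
  rewrite -[RHS](integral0 mu setT); apply: eq_integral => v _.
  by rewrite /record_value /record_step/= ifF//; apply/negbTE; rewrite negb_and ok.
rewrite -(right_cdf_harmonic nuD y0 a0 ab b1); apply: eq_integral => v _.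
rewrite /record_value /record_step /=; move: ok; rewrite /S/= => ->.
by [].
Qed.

(** The exponent is [n] for [n.+1] points because the first point has no prescribed law. *)
Lemma prob_prefix_pow (B : set R) (b : R) n : measurable B -> 0 <= b ->
  mu B = b%:E ->
  (P [set w | forall i, (i <= n)%N -> B (X i w)] <= (b ^+ n)%:E)%E.
Proof.
move=> mB b0 muB; elim: n => [|n ih].
  rewrite expr0; apply: probability_le1.
  rewrite (_ : [set w | _] = X 0%N @^-1` B); first exact: measurable_funPTI.
  by apply/seteqP; split => w /=; [exact|move=> ? i; rewrite leqn0 => /eqP ->].
rewrite (Xind n (B := fun=> B))// muB exprSr EFinM.
by rewrite lee_wpmul2r// lee_fin.
Qed.

Lemma run_max_lt (x : nat -> R) c n : (run_max x n < c) <-> (forall i, (i <= n)%N -> x i < c).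
Proof.
elim: n => [|n ih] /=.
  by split=> [h i|]; [rewrite leqn0 => /eqP ->|exact].
rewrite gt_max; split=> [/andP[/ih h1 h2] i|h].
  by rewrite leq_eqVlt => /predU1P[->//|]; exact: h1.
by rewrite h// andbT; apply/ih => i ilt; apply: h; exact: leqW.
Qed.

Lemma run_min_gt (x : nat -> R) c n : (c < run_min x n) <-> (forall i, (i <= n)%N -> c < x i).
Proof.
elim: n => [|n ih] /=.
  by split=> [h i|]; [rewrite leqn0 => /eqP ->|exact].
rewrite lt_min; split=> [/andP[/ih h1 h2] i|h].
  by rewrite leq_eqVlt => /predU1P[->//|]; exact: h1.
by rewrite h// andbT; apply/ih => i ilt; apply: h; exact: leqW.
Qed.

(* Once the range contains [[y, 1 - y]], no further long edge can appear and
   [record_value] is the indicator of [short_records]. *)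
Lemma short_records_cvg :
  P [set w | short_records y (X ^~ w) n] @[n --> \oo] -->
  (\int[P]_w (h (X 0%N w) * h (1 - X 0%N w)%R))%E.
Proof.
have y0R : (0 : R) < y := y0.
have y1R : y < 1 :> R := y1.
pose I := (\int[P]_w (h (X 0%N w) * h (1 - X 0%N w)%R))%E.
pose G n : set T := [set w | short_records y (X ^~ w) n].
(* On [L n] the maximum has not yet reached [1 - y]; on [U n] the minimum has not yet come down to
   [y]. *)
pose L n : set T := [set w | forall i, (i <= n)%N -> `]-oo, (1 - y)[%classic (X i w)].
pose U n : set T := [set w | forall i, (i <= n)%N -> `]y, +oo[%classic (X i w)].
have mG n : measurable (G n).
  rewrite -[X in measurable X]setTI.
  exact: (measurable_short_records y n (fun i => measurable_funPT (X i))
    measurableT (Y := [set true])).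
have mL n : measurable (L n).
  rewrite (_ : L n = (fun w => run_max (X ^~ w) n) @^-1` `]-oo, (1 - y)[).
    rewrite -[X in measurable X]setTI.
    exact: (measurable_run_max n (fun i => measurable_funPT (X i))).
  apply/seteqP; split => w; rewrite /L/= ?in_itv/=.
    by move=> hi; apply/run_max_lt => i /hi; rewrite in_itv.
  by move=> /run_max_lt hi i /hi; rewrite in_itv.
have mU n : measurable (U n).
  rewrite (_ : U n = (fun w => run_min (X ^~ w) n) @^-1` `]y, +oo[).
    rewrite -[X in measurable X]setTI.
    exact: (measurable_run_min n (fun i => measurable_funPT (X i))).
  apply/seteqP; split => w; rewrite /U/= ?in_itv/= ?andbT.
    by move=> hi; apply/run_min_gt => i /hi; rewrite in_itv/= andbT.
  by move=> /run_min_gt hi i /hi; rewrite in_itv/= andbT.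
have mZ n : measurable_fun setT (fun w => record_value (S n w)).
  exact: (measurableT_comp measurable_record_value (measurable_S n)).
(* The value is at most the indicator of [G n], and its mean is [I]. *)
have lower n : (I <= P (G n))%E.
  rewrite /I -(integral_record_value n) -[in leRHS](setIT (G n)) -integral_indic//.
  apply: ge0_le_integral => //.
  - by move=> w _; exact: record_value_ge0.
  - by apply/measurable_EFinP; exact: measurable_indic.
  - move=> w _; rewrite /record_value /= indicE; case: ifPn => ok.
      rewrite mem_set// -[leRHS]mule1.
      by apply: lee_pmul; rewrite ?right_cdf_ge0 ?right_cdf_le1.
    by rewrite lee_fin.
(* Off [L n] and [U n], both factors of the value are 1 by [right_cdf1], so there the indicator of
   [G n] equals the value. *)
have upper n : (P (G n) <= I + (((1 - y) ^+ n)%:E + ((1 - y) ^+ n)%:E))%E.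
  have PL : (P (L n) <= ((1 - y) ^+ n)%:E)%E.
    apply: prob_prefix_pow => //; first lra.
    by apply: unif01_itvNyo; apply/andP; split; lra.
  have PU : (P (U n) <= ((1 - y) ^+ n)%:E)%E.
    apply: prob_prefix_pow => //; first lra.
    by apply: unif01_itvoy; apply/andP; split; lra.
  apply: (@le_trans _ _ (I + (P (L n) + P (U n)))%E); last by rewrite leeD2l// leeD.
  have mi (D : set T) : measurable D -> measurable_fun setT (fun w => (\1_D w)%:E : \bar R).
    by move=> mD; apply/measurable_EFinP; exact: measurable_indic.
  rewrite /I -(integral_record_value n).
  rewrite -[in P (G n)](setIT (G n)) -[in P (L n)](setIT (L n)) -[in P (U n)](setIT (U n)).
  rewrite -!integral_indic// -ge0_integralD//; [|exact: mi|exact: mi].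
  rewrite -ge0_integralD//; last 3 first.
  - by move=> w _; exact: record_value_ge0.
  - by move=> w _; rewrite adde_ge0// lee_fin.
  - by apply: emeasurable_funD; exact: mi.
  apply: ae_ge0_le_integral => //.
  - exact: mi.
  - by move=> w _; rewrite !adde_ge0// ?record_value_ge0// lee_fin.
  - by do 2 apply: emeasurable_funD => //; exact: mi.
  apply: filterS record_state_itv => w /(_ n)[a0 ab b1] _.
  rewrite !indicE; have [ok|] := boolP (w \in G n); last first.
    by move=> _; rewrite !adde_ge0// ?record_value_ge0// lee_fin.
  have [/= _|wL] := boolP (w \in L n).
    by rewrite -[leLHS]adde0 addeCA leeD// adde_ge0// ?record_value_ge0//.
  have [/= _|wU] := boolP (w \in U n).
    by rewrite add0e -[leLHS]add0e leeD// record_value_ge0.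
  have hmax : 1 - y <= run_max (X ^~ w) n.
    rewrite leNgt; apply: contra wL => /run_max_lt hi; rewrite inE => i /hi.
    by rewrite /= in_itv.
  have hmin : run_min (X ^~ w) n <= y.
    rewrite leNgt; apply: contra wU => /run_min_gt hi; rewrite inE => i /hi.
    by rewrite /= in_itv/= andbT.
  rewrite !adde0 /record_value; move: ok; rewrite inE /G/= => ->.
  rewrite !right_cdf1 ?mule1//; rewrite /S/= in a0 ab b1 *; lra.
apply: (@squeeze_cvge _ _ _ _ (fun=> I) _ (fun n => I + (((1 - y) ^+ n)%:E + ((1 - y) ^+ n)%:E))%E).
- by apply: nearW => n; rewrite lower upper.
- exact: cvg_cst.
rewrite -[X in _ --> X]adde0 -[X in _ --> (_ + X)%E](adde0 0%E).
have pw : ((1 - y) ^+ n)%:E @[n --> \oo] --> (0%E : \bar R).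
  apply: cvg_EFin; first exact: nearW.
  by apply: cvg_expr; rewrite ger0_norm; lra.
apply: cvgeD => //; first by rewrite fin_num_adde_defl// adde0.
  exact: cvg_cst.
by apply: cvgeD.
Qed.

End record_martingale.

(** * Identification of the limits *)

(** The two laws put no mass above 1, and the second none on []-oo, 0]], so the open unit interval
    carries all the information. *)
Lemma eq_law_of_cdf (R : realType) (d1 d2 : measure_display)
    (T1 : measurableType d1) (T2 : measurableType d2)
    (P1 : probability T1 R) (P2 : probability T2 R)
    (Y1 : {RV P1 >-> R}) (Y2 : {RV P2 >-> R}) :
  (forall y, 0 < y < 1 -> cdf Y1 y = cdf Y2 y) ->
  ccdf Y1 1 = 0%E -> ccdf Y2 1 = 0%E -> cdf Y2 0 = 0%E ->
  forall A, measurable A -> P1 (Y1 @^-1` A) = P2 (Y2 @^-1` A).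
Proof.
move=> eqY top1 top2 bot2.
(* Near 0 on the right the two functions agree, so right continuity of the second bounds the first
   at 0. *)
have bot1 : cdf Y1 0 = 0%E.
  apply/eqP; rewrite eq_le cdf_ge0 andbT -bot2.
  apply: (cvge_ge _ (@cdf_right_continuous _ _ _ P2 Y2 0)).
  near=> y.
  have y01 : 0 < y < 1 by apply/andP; split; near: y; [exact: nbhs_right_gt|exact: nbhs_right_lt].
  by rewrite -eqY// cdf_nondecreasing//; case/andP: y01 => /ltW.
have ccdfE d (T : measurableType d) (P : probability T R) (Y : {RV P >-> R}) x :
    ccdf Y x = (1 - cdf Y x)%E.
  have <- := cdf_ccdf_1 Y x; rewrite addeAC subee ?add0e//.
  exact: fin_num_measure.
apply: (finite_measure_eq_itvoy (m1 := distribution P1 Y1) (m2 := distribution P2 Y2)).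
  by move=> x; rewrite -ge0_fin_numE// fin_num_measure.
move=> x; rewrite -[LHS]/(ccdf Y1 x) -[RHS]/(ccdf Y2 x).
have [x0|x0] := leP x 0.
  have lt0 d (T : measurableType d) (P : probability T R) (Y : {RV P >-> R}) :
      cdf Y 0 = 0%E -> ccdf Y x = 1%E.
    move=> Y0; rewrite ccdfE (_ : cdf Y x = 0%E) ?sube0//.
    by apply/eqP; rewrite eq_le cdf_ge0 andbT -Y0 cdf_nondecreasing.
  by rewrite !lt0.
have [x1|x1] := ltP x 1; first by rewrite !ccdfE eqY// x0.
have gt1 d (T : measurableType d) (P : probability T R) (Y : {RV P >-> R}) :
    ccdf Y 1 = 0%E -> ccdf Y x = 0%E.
  move=> Y1'; apply/eqP; rewrite eq_le measure_ge0 andbT -Y1'.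
  exact: ccdf_nonincreasing.
by rewrite !gt1.
Unshelve. all: by end_near. Qed.

Section unit_interval_limit.
Context (R : realType) (dT : measure_display) (T : measurableType dT).
Variables (P : probability T R) (X : nat -> {mfun T >-> R}).
Hypothesis X01 : forall i, \forall w \ae P, 0 <= X i w <= 1.
Hypothesis Xind : forall n (B : nat -> set R), (forall i, measurable (B i)) ->
  P [set w | forall i, (i <= n.+1)%N -> B i (X i w)] =
  (P [set w | forall i, (i <= n)%N -> B i (X i w)] * unif01 R (B n.+1))%E.

Lemma measurable_tuple1 (f : T -> R) : measurable_fun setT f ->
  measurable_fun setT (fun w => [tuple f w] : 1.-tuple R).
Proof.
move=> mf; apply/measurable_fun_tnthP => i; apply: eq_measurable_fun mf => w _ /=.
by rewrite ord1.
Qed.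

Let x i w : 1.-tuple R := [tuple X i w].

Lemma measurable_ong_lim1 : measurable_fun setT (ong_lim x).
Proof. by apply: measurable_ong_lim => i; exact: measurable_tuple1. Qed.

(** Both sides are limits of the same sequence of probabilities, by [ong_cdf_cvg] and
    [short_records_cvg]. *)
Lemma ong_lim1_cdf (nu : probability R R) (y : R) : dickman_law nu -> 0 < y < 1 ->
  P [set w | ong_lim x w <= y] =
  (\int[P]_w (right_cdf nu y (X 0%N w) * right_cdf nu y (1 - X 0%N w)%R))%E.
Proof.
move=> nuD /andP[y0 y1].
have h1 := short_records_cvg nuD y0 y1 X01 Xind.
have mx i : measurable_fun setT (x i) by exact: measurable_tuple1.
have y1' : y < Num.sqrt 1%:R by rewrite sqrtr1.
(* The index is shifted because [short_records] at [n] concerns [n.+1] points. *)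
have := ong_cdf_cvg (P := P) mx y1'; rewrite -cvg_shiftS => h2.
apply: (cvg_unique _ h2) => //.
apply: cvg_trans h1; apply: near_eq_cvg; apply: nearW => n /=.
by congr (P _); apply/seteqP; split => w /=; rewrite ong_max_le_short_records// ltW.
Qed.

(** This holds everywhere, thanks to the truncation in [cap_lim]. *)
Lemma ong_lim1_le1 w : ong_lim x w <= 1.
Proof.
rewrite -[leRHS]sqrtr1; apply: limr_le.
  apply/cvg_ex; exists (ong_lim x w); apply: cap_lim_cvg => {}w.
  exact: ong_max_mkseq_nd.
by apply: nearW => n; rewrite ge_min lexx orbT.
Qed.

End unit_interval_limit.

(** * Uniform points of the interval, with or without an initial 0 *)

Section unit_interval_points.
Context (R : realType) (dT : measure_display) (T : measurableType dT).
Variables (P : probability T R) (U : nat -> {RV P >-> 1.-tuple R}).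
Hypothesis iidU : iid_uniform_cube U.

Let measurable_coord i : measurable_fun setT (fun w => tnth (U i w) ord0).
Proof. exact: (measurableT_comp (measurable_tnth ord0) (measurable_funPT (U i))). Qed.

Definition coord i : {mfun T >-> R} := HB.pack_for {mfun T >-> R}
  (fun w => tnth (U i w) ord0) (isMeasurableFun.Build _ _ _ _ _ (@measurable_coord i)).

Lemma coordE i w : U i w = [tuple coord i w].
Proof. by apply: eq_from_tnth => k; rewrite [k]ord1. Qed.

Lemma coord_unit i : \forall w \ae P, 0 <= coord i w <= 1.
Proof. by apply: filterS (uniform_cube_unit (iidU.1 i)) => w; exact. Qed.

Lemma coord_law i (B : set R) : measurable B -> P (coord i @^-1` B) = unif01 R B.
Proof.
move=> mB; rewrite unif01E.
have := iidU.1 i (fun=> B) (fun=> mB); rewrite big_ord1 => <-.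
congr (P _); apply/seteqP; split => w /=; last by exact.
by move=> h k; rewrite [k]ord1.
Qed.

(** Strict bounds admit the empty prefix, which occurs in [from_zero_indep], where the first random
    point has index 1. *)
Lemma coord_prefix n (B : nat -> set R) : (forall i, measurable (B i)) ->
  P [set w | forall i, (i < n.+1)%N -> B i (coord i w)] =
  (P [set w | forall i, (i < n)%N -> B i (coord i w)] * unif01 R (B n))%E.
Proof.
move=> mB; pose C i : set (1.-tuple R) := (fun t => tnth t ord0) @^-1` B i.
have mC i : measurable (C i) by rewrite -[C i]setTI; exact: measurable_tnth.
rewrite -[X in P X]/[set w | forall i, (i < n.+1)%N -> C i (U i w)].
rewrite -[X in (P X * _)%E]/[set w | forall i, (i < n)%N -> C i (U i w)].
rewrite !(indep_family_prefix _ iidU.2 mC) big_ord_recr/=.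
by congr (_ * _)%E; exact: coord_law.
Qed.

Lemma coord_indep n (B : nat -> set R) : (forall i, measurable (B i)) ->
  P [set w | forall i, (i <= n.+1)%N -> B i (coord i w)] =
  (P [set w | forall i, (i <= n)%N -> B i (coord i w)] * unif01 R (B n.+1))%E.
Proof. exact: (@coord_prefix n.+1). Qed.

Definition from_zero i : {mfun T >-> R} := if i is j.+1 then coord j else cst 0.

Lemma from_zero_unit i : \forall w \ae P, 0 <= from_zero i w <= 1.
Proof.
case: i => [|i]; last exact: coord_unit.
by apply: aeW => w /=; rewrite lexx ler01.
Qed.

Lemma from_zero_indep n (B : nat -> set R) : (forall i, measurable (B i)) ->
  P [set w | forall i, (i <= n.+1)%N -> B i (from_zero i w)] =
  (P [set w | forall i, (i <= n)%N -> B i (from_zero i w)] * unif01 R (B n.+1))%E.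
Proof.
move=> mB.
(* The condition on the constant point 0 either empties both events or disappears. *)
have [B0|B0] := pselect (B 0%N 0); last first.
  have E m : [set w | forall i, (i <= m)%N -> B i (from_zero i w)] = set0.
    by apply/seteqP; split => // w /= /(_ 0%N isT).
  by rewrite !E measure0 mul0e.
have E m : [set w | forall i, (i <= m)%N -> B i (from_zero i w)] =
    [set w | forall i, (i < m)%N -> B i.+1 (coord i w)].
  apply/seteqP; split => w /= h i; first by move=> im; exact: (h i.+1).
  by case: i => [//|i im]; exact: h.
by rewrite !E (@coord_prefix n (fun i => B i.+1)).
Qed.

End unit_interval_points.

Lemma ae_measure0 (R : realType) (dT : measure_display) (T : measurableType dT)
    (P : probability T R) (A : set T) :
  measurable A -> (\forall w \ae P, ~ A w) -> P A = 0%E.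
Proof.
move=> mA h; apply/negligibleP => //.
by apply: negligibleS h => w Aw /=; apply.
Qed.

(** * The maximum of two max-Dickman variables scaled by a uniform split *)

Section max_dickman_pair.
Context (R : realType) (dT : measure_display) (T : measurableType dT).
Variables (P : probability T R) (V M1 M2 : {RV P >-> R}).
Hypotheses (uV : uniform01 V) (D1 : dickman_law (distribution P M1))
  (D2 : dickman_law (distribution P M2)).
Hypothesis ind :
  indep_family P (fun i : 'I_3 => sigma_rv (tnth [tuple V; M1; M2] i)).

Lemma indep_triple (A B C : set R) : measurable A -> measurable B -> measurable C ->
  P (V @^-1` A `&` M1 @^-1` B `&` M2 @^-1` C) =
  (P (V @^-1` A) * P (M1 @^-1` B) * P (M2 @^-1` C))%E.
Proof.
move=> mA mB mC.
pose F (i : 'I_3) := tnth [tuple V @^-1` A; M1 @^-1` B; M2 @^-1` C] i.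
pose J := [fset i in enum 'I_3]%fset.
have Jin i : i \in J by rewrite !inE /= mem_enum.
have := ind (J := J) (A := F); rewrite (_ : (\prod_(i <- J) P (F i) = \prod_(i < 3) P (F i))%E).
  rewrite !big_ord_recl big_ord0 mule1 muleA => <-.
    congr (P _); apply/seteqP; split => w /=.
      by move=> [[h1 h2] h3] [[|[|[|//]]] i3] _.
    move=> h; split; first split.
    - exact: (h ord0 (Jin _)).
    - exact: (h (lift ord0 ord0) (Jin _)).
    - exact: (h (lift ord0 (lift ord0 ord0)) (Jin _)).
  move=> [[|[|[|//]]] i3] _; rewrite /F /sigma_rv /=.
  - by exists A => //; rewrite setTI.
  - by exists B => //; rewrite setTI.
  - by exists C => //; rewrite setTI.
apply: perm_big; apply: uniq_perm; rewrite ?index_enum_uniq ?fset_uniq// => i.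
by rewrite Jin mem_index_enum.
Qed.

Definition split_max w : R := Num.max (V w * M1 w) ((1 - V w) * M2 w).

Lemma measurable_split_max : measurable_fun setT split_max.
Proof.
apply: measurable_maxr; apply: measurable_funM => //.
exact: measurable_funB.
Qed.

Local Notation nu1 := (distribution P M1).
Local Notation nu2 := (distribution P M2).

(** Given [V = v], the conditions on [M1] and [M2] are independent. Since [v = 1 - (1 - v)], the one
    on [M1] is [right_cdf] at [1 - v]. *)
Lemma split_max_cdf y :
  P [set w | split_max w <= y] =
  (\int[unif01 R]_v (right_cdf nu2 y v * right_cdf nu1 y (1 - v)%R))%E.
Proof.
have mVM : measurable_fun setT (fun w => [tuple V w; M1 w] : 2.-tuple R).
  apply/measurable_fun_tnthP => -[[|[|//]] i2]; exact: measurable_funPT.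
pose VM : {mfun T >-> 2.-tuple R} := HB.pack (fun w => [tuple V w; M1 w])
  (isMeasurableFun.Build _ _ _ _ _ mVM).
pose o0 : 'I_2 := ord0; pose o1 : 'I_2 := lift ord0 ord0.
have mt0 : measurable_fun setT (fun z : 2.-tuple R * R => tnth z.1 o0).
  exact: (measurableT_comp (measurable_tnth o0) measurable_fst).
have mt1 : measurable_fun setT (fun z : 2.-tuple R * R => tnth z.1 o1).
  exact: (measurableT_comp (measurable_tnth o1) measurable_fst).
pose D := [set z : 2.-tuple R * R |
  Num.max (tnth z.1 o0 * tnth z.1 o1) ((1 - tnth z.1 o0) * z.2) <= y].
have mD : measurable D.
  rewrite -[D]setTI -[X in _ `&` X]/((fun z : 2.-tuple R * R => Num.max
    (tnth z.1 o0 * tnth z.1 o1) ((1 - tnth z.1 o0) * z.2)) @^-1` [set t | t <= y]).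
  suff mf : measurable_fun setT (fun z : 2.-tuple R * R => Num.max
      (tnth z.1 o0 * tnth z.1 o1) ((1 - tnth z.1 o0) * z.2)).
    by apply: mf => //; rewrite -set_itvNyc.
  apply: measurable_maxr; apply: measurable_funM => //.
  exact: measurable_funB.
rewrite -[LHS]/(P [set w | D (VM w, M2 w)]).
rewrite (prob_indep_pair (m := nu2))//; last first.
  apply: indep_tuple_box => B C mB mC.
  have -> : [set w | forall k, B k (tnth (VM w) k)] = V @^-1` B o0 `&` M1 @^-1` B o1.
    apply/seteqP; split => w /=; first by move=> h; split; [exact: (h o0)|exact: (h o1)].
    move=> [h0 h1] k; have [->|k0] := eqVneq k o0; first exact: h0.
    rewrite (_ : k = o1); first exact: h1.
    by apply/val_inj; case: k k0 => -[|[|//]].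
  rewrite indep_triple//; congr (_ * _)%E.
  have := indep_triple (mB o0) (mB o1) measurableT.
  by rewrite preimage_setT setIT => ->; rewrite probability_setT mule1.
have mh2 := measurable_right_cdf nu2 y.
have mh1 := measurable_right_cdf nu1 y.
(* [f (V w, M1 w)] is what remains after [M2] has been integrated out. *)
pose f (z : R * R) := if z.1 * z.2 <= y then right_cdf nu2 y z.1 else 0%E.
have mf : measurable_fun setT f.
  apply: measurable_fun_ifT => //; last exact: (measurableT_comp mh2 measurable_fst).
  by apply: measurable_fun_ler => //; exact: measurable_funM.
transitivity (\int[P]_w f (V w, M1 w))%E.
  apply: eq_integral => w _; rewrite /D /f/=.
  case: ifPn => hw.
    by congr (P _); apply/seteqP; split => t /=; rewrite ge_max hw.
  rewrite (_ : [set _ | _] = set0) ?measure0//.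
  by apply/seteqP; split => // m /=; rewrite ge_max (negbTE hw).
rewrite (integral_indep_pair (m := nu1))//; last 2 first.
- move=> A B mA mB; have := indep_triple mA mB measurableT.
  by rewrite preimage_setT setIT => ->; rewrite probability_setT mule1.
- by move=> z; rewrite /f; case: ifP => // _; exact: right_cdf_ge0.
have E v : (\int[nu1]_m f (v, m) = right_cdf nu2 y v * right_cdf nu1 y (1 - v)%R)%E.
  pose A := [set m | (1 - (1 - v)) * m <= y].
  have mA : measurable A.
    rewrite -[A]setTI -[X in _ `&` X]/((fun m => (1 - (1 - v)) * m) @^-1` [set t | t <= y]).
    suff mg : measurable_fun setT (fun m : R => (1 - (1 - v)) * m).
      by apply: mg => //; rewrite -set_itvNyc.
    exact: measurable_funM.
  have AE : (\int[nu1]_m (\1_A m)%:E = right_cdf nu1 y (1 - v)%R)%E.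
    by rewrite (integral_indic nu1 measurableT mA) setIT.
  rewrite -AE -ge0_integralZl//; last first.
    by apply/measurable_EFinP; exact: measurable_indic.
  apply: eq_integral => m _; rewrite /f/= indicE.
  have -> : (m \in A) = (v * m <= y) by apply/idP/idP; rewrite inE /A/= subKr.
  by case: ifP; rewrite ?mule1 ?mule0.
under eq_integral do rewrite E.
rewrite -(@ge0_integral_distribution _ _ _ _ _ P V
  (fun v => right_cdf nu2 y v * right_cdf nu1 y (1 - v)%R)%E).
- by apply: eq_measure_integral => B mB _; exact: uV.
- apply: emeasurable_funM => //; apply: (measurableT_comp mh1).
  exact: measurable_funB.
- by move=> v; rewrite mule_ge0// right_cdf_ge0.
Qed.

Lemma split_max_ae : \forall w \ae P, 0 < split_max w <= 1.
Proof.
have aV : \forall w \ae P, 0 < V w < 1.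
  have mI : measurable (`]0, 1[%classic : set R) by [].
  suff : P (V @^-1` (~` `]0, 1[)) = 0%E.
    move=> h; exists (V @^-1` (~` `]0, 1[)); split.
    - by apply: measurable_funPTI; exact: measurableC.
    - exact: h.
    - by move=> w /=; apply: contra_not; rewrite in_itv.
  rewrite [LHS](uV (measurableC mI)) -unif01E.
  apply: ae_measure0; first exact: measurableC.
  by apply: filterS (unif01_ae R) => u u01 /=; apply; rewrite in_itv.
have aM (M : {RV P >-> R}) : dickman_law (distribution P M) -> \forall w \ae P, 0 < M w <= 1.
  move=> DM.
  have a0 : \forall w \ae P, 0 < M w.
    exists (M @^-1` `]-oo, 0]); split; first exact: measurable_funPTI.
      exact: dickman_law_le0 DM.
    by move=> w /=; rewrite in_itv/= leNgt => /negP.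
  have a1 : \forall w \ae P, M w <= 1.
    exists (M @^-1` `]1, +oo[); split; first exact: measurable_funPTI.
      exact: dickman_law_gt1 DM.
    by move=> w /=; rewrite in_itv/= andbT ltNge => /negP.
  by apply: filterS2 a0 a1 => w -> ->.
apply: filterS3 aV (aM _ D1) (aM _ D2) => w /andP[v0 v1] /andP[m0 m1] /andP[n0 n1].
rewrite /split_max lt_max ge_max mulr_gt0//=; apply/andP; split; nra.
Qed.

End max_dickman_pair.

Section cdf_of_laws.
Context (R : realType) (dT : measure_display) (T : measurableType dT).
Variables (P : probability T R) (M : {RV P >-> R}).

Lemma dickman_cdf0 : dickman_law (distribution P M) -> cdf M 0 = 0%E.
Proof. exact: dickman_law_le0. Qed.

Lemma dickman_ccdf1 : dickman_law (distribution P M) -> ccdf M 1 = 0%E.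
Proof. exact: dickman_law_gt1. Qed.

Lemma cdf0_ae : (\forall w \ae P, 0 < M w) -> cdf M 0 = 0%E.
Proof.
move=> h; apply: (ae_measure0 (P := P) (A := M @^-1` `]-oo, 0])); first exact: measurable_funPTI.
by apply: filterS h => w; rewrite ltNge => /negP + h; apply; move: h; rewrite /= in_itv.
Qed.

Lemma ccdf1_ae : (\forall w \ae P, M w <= 1) -> ccdf M 1 = 0%E.
Proof.
move=> h; apply: (ae_measure0 (P := P) (A := M @^-1` `]1, +oo[)); first exact: measurable_funPTI.
by apply: filterS h => w; rewrite leNgt => /negP + h; apply; move: h; rewrite /= in_itv/= andbT.
Qed.

Lemma cdfE y : cdf M y = P [set w | M w <= y].
Proof. by congr (P _); apply/seteqP; split => w; rewrite /= in_itv. Qed.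

End cdf_of_laws.

Lemma cvg_in_distribution_ong (R : realType) (d : nat)
    (dQ dT : measure_display) (TQ : measurableType dQ) (T : measurableType dT)
    (PQ : probability TQ R) (P : probability T R) (Q : {RV PQ >-> R})
    (x : nat -> T -> d.-tuple R) (K : nat -> T -> nat) :
  (forall i, measurable_fun setT (x i)) ->
  (forall i, \forall w \ae P, forall k, 0 <= tnth (x i w) k <= 1) ->
  (forall n, measurable_fun setT (K n)) ->
  (\forall w \ae P, forall k, exists n0, forall n, (n0 <= n)%N -> (k <= K n w)%N) ->
  (forall f : R -> R, continuous f -> (exists C, forall y, `|f y| <= C) ->
    'E_P[f \o ong_lim x]%E = 'E_PQ[f \o Q]%E) ->
  cvg_in_distribution P (fun n w => ong_max (mkseq (x ^~ w) (K n w))) Q.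
Proof.
move=> mx cube mK Kinf eqE; split=> [n|f cf bf].
  apply: (measurable_fun_random_index (X := fun n w => ong_max (mkseq (x ^~ w) n))) => // m.
  exact: measurable_ong_max.
by rewrite -eqE//; exact: ong_expectation_cvg.
Qed.

(** * The graph started at the origin *)

Section origin.
Context (R : realType) (dT dM : measure_display) (T : measurableType dT)
  (TM : measurableType dM) (P : probability T R) (PM : probability TM R).
Variables (U : nat -> {RV P >-> 1.-tuple R}) (M : {RV PM >-> R}).
Hypotheses (iidU : iid_uniform_cube U) (DM : max_dickman M).

Let x i w : 1.-tuple R := [tuple from_zero U i w].

Let mx i : measurable_fun setT (x i).
Proof. exact/measurable_tuple1/measurable_funPT. Qed.

Lemma origin_mkseq n w :
  origin :: mkseq (fun i => U i w) n = mkseq (x ^~ w) n.+1.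
Proof.
rewrite /mkseq/= -[iota 1 n]/(iota (1 + 0) n) iotaDl -map_comp; congr (_ :: _).
  by apply: eq_from_tnth => k; rewrite tnth_mktuple [k]ord1.
by apply: eq_map => i; exact: coordE.
Qed.

(** The initial range is reduced to 0, where the harmonic function is [right_cdf] at 0 times
    [right_cdf] at 1. The latter is 1 and the former is the distribution function of [M]. *)
Lemma origin_limit_law (f : R -> R) :
  continuous f -> (exists C, forall y, `|f y| <= C) ->
  'E_P[f \o ong_lim x]%E = 'E_PM[f \o M]%E.
Proof.
move=> cf bf; have nuD := max_dickman_law DM.
pose Q : {RV P >-> R} := HB.pack_for {mfun T >-> R} (ong_lim x)
  (isMeasurableFun.Build _ _ _ _ _ (measurable_ong_lim1 (from_zero U))).
apply: (expectation_eq_law (X1 := Q) (X2 := M)) => //.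
  exact: continuous_measurable_fun.
apply: eq_law_of_cdf => [y y01|||].
- rewrite !cdfE [LHS](ong_lim1_cdf (from_zero_unit iidU) (from_zero_indep iidU) nuD y01).
  case/andP: y01 => y0 y1.
  transitivity (\int[P]_w (cst (right_cdf (distribution PM M) y 0) w))%E.
    apply: eq_integral => w _; rewrite /= subr0.
    by rewrite [X in (_ * X)%E](right_cdf1 nuD) ?mule1//; lra.
  rewrite integral_cst// [X in (_ * X)%E](probability_setT P) mule1 /right_cdf.
  by congr (PM _); apply/seteqP; split => w; rewrite /= subr0 mul1r.
- by apply: ccdf1_ae; apply: aeW => w; exact: ong_lim1_le1.
- exact: dickman_ccdf1.
- exact: dickman_cdf0.
Qed.

Lemma cvg_origin (K : nat -> T -> nat) :
  (forall n, measurable_fun setT (K n)) ->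
  (\forall w \ae P, forall k, exists n0, forall n, (n0 <= n)%N -> (k <= K n w)%N) ->
  cvg_in_distribution P
    (fun n w => ong_max (origin :: mkseq (fun i => U i w) (K n w))) M.
Proof.
move=> mK Kinf; under [X in cvg_in_distribution _ X _]eq_fun do
  under eq_fun do rewrite origin_mkseq.
(* The origin counts as one more point. *)
apply: (@cvg_in_distribution_ong _ _ _ _ _ _ _ _ _ x (fun n w => (K n w).+1)) => //.
- move=> i; apply: filterS (from_zero_unit iidU i) => w h k.
  by rewrite [k]ord1.
- by move=> n; exact: (measurableT_comp (f := S)).
- apply: filterS Kinf => w h k; have [n0 hn0] := h k; exists n0 => n /hn0.
  exact: leqW.
- exact: origin_limit_law.
Qed.

End origin.

(** * One limit variable for all probability spaces *)

Section reference_space.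
Context (R : realType) (d : nat) (dQ : measure_display) (TQ : measurableType dQ)
  (PQ : probability TQ R).
Variable U0 : nat -> {RV PQ >-> d.-tuple R}.
Hypothesis iid0 : iid_uniform_cube U0.

Let mQ : measurable_fun setT (ong_lim (fun i w => U0 i w)).
Proof. by apply: measurable_ong_lim => i; exact: measurable_funPT. Qed.

Definition ong_limit_rv : {RV PQ >-> R} := HB.pack_for {mfun TQ >-> R}
  (ong_lim (fun i w => U0 i w)) (isMeasurableFun.Build _ _ _ _ _ mQ).

(** The expectations under the two pathwise limits are limits of one and the same numerical
    sequence, by [iid_expectation_ong]. *)
Lemma cvg_no_origin (dT : measure_display) (T : measurableType dT)
    (P : probability T R) (U : nat -> {RV P >-> d.-tuple R}) (K : nat -> T -> nat) :
  iid_uniform_cube U ->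
  (forall n, measurable_fun setT (K n)) ->
  (\forall w \ae P, forall k, exists n0, forall n, (n0 <= n)%N -> (k <= K n w)%N) ->
  cvg_in_distribution P
    (fun n w => ong_max (mkseq (fun i => U i w) (K n w))) ong_limit_rv.
Proof.
move=> iidU mK Kinf.
apply: cvg_in_distribution_ong => //.
- by move=> i; exact: uniform_cube_unit (iidU.1 i).
move=> f cf bf.
have h1 := ong_expectation_cvg_nat (fun i => measurable_funPT (U i))
  (fun i => uniform_cube_unit (iidU.1 i)) cf bf.
have h2 := ong_expectation_cvg_nat (fun i => measurable_funPT (U0 i))
  (fun i => uniform_cube_unit (iid0.1 i)) cf bf.
apply: (cvg_unique _ h1) => //.
apply: cvg_trans h2; apply: near_eq_cvg; apply: nearW => n.
exact: iid_expectation_ong.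
Qed.

End reference_space.

(** The laws of [M1] and [M2] may be replaced by [nu] because [right_cdf_unique] leaves only one
    solution on the unit interval. *)
Lemma split_max_integral (R : realType) (dT : measure_display)
    (T : measurableType dT) (P : probability T R) (V M1 M2 : {RV P >-> R})
    (nu : probability R R) (y : R) :
  uniform01 V -> max_dickman M1 -> max_dickman M2 ->
  indep_family P (fun i : 'I_3 => sigma_rv (tnth [tuple V; M1; M2] i)) ->
  dickman_law nu -> 0 < y < 1 ->
  P [set w | split_max V M1 M2 w <= y] =
  (\int[unif01 R]_v (right_cdf nu y v * right_cdf nu y (1 - v)%R))%E.
Proof.
move=> uV /max_dickman_law D1 /max_dickman_law D2 ind nuD y01.
rewrite split_max_cdf//.
have mh (n : probability R R) := measurable_right_cdf n y.
have mh' (n : probability R R) : measurable_fun setT (fun v : R => right_cdf n y (1 - v)).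
  by apply: (measurableT_comp (mh n)); exact: measurable_funB.
apply: ae_eq_integral => //; [exact: emeasurable_funM|exact: emeasurable_funM|].
apply: filterS (unif01_ae R) => v /andP[v0 v1] _.
rewrite (right_cdf_unique D2 nuD) ?(right_cdf_unique D1 nuD)//.
  by apply/andP; split; lra.
by apply/andP; split; lra.
Qed.

Lemma split_max_law (R : realType) (dT dQ : measure_display)
    (T : measurableType dT) (TQ : measurableType dQ)
    (P : probability T R) (PQ : probability TQ R)
    (V M1 M2 : {RV P >-> R}) (Q : {RV PQ >-> R}) :
  uniform01 V -> max_dickman M1 -> max_dickman M2 ->
  indep_family P (fun i : 'I_3 => sigma_rv (tnth [tuple V; M1; M2] i)) ->
  (\forall w \ae PQ, Q w <= 1) ->
  (forall nu y, dickman_law nu -> 0 < y < 1 -> PQ [set w | Q w <= y] =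
    (\int[unif01 R]_v (right_cdf nu y v * right_cdf nu y (1 - v)%R))%E) ->
  eq_in_distribution PQ P Q (fun w => Num.max (V w * M1 w) ((1 - V w) * M2 w)).
Proof.
move=> uV D1 D2 ind Q1 QE; split; [exact: measurable_funPT|exact: measurable_split_max|].
pose W : {RV P >-> R} := HB.pack_for {mfun T >-> R} (split_max V M1 M2)
  (isMeasurableFun.Build _ _ _ _ _ (measurable_split_max V M1 M2)).
have W01 := split_max_ae uV (max_dickman_law D1) (max_dickman_law D2).
apply: (eq_law_of_cdf (Y1 := Q) (Y2 := W)) => [y y01|||].
- have nuD := max_dickman_law D1.
  by rewrite !cdfE (QE _ _ nuD y01) [RHS](split_max_integral uV D1 D2 ind nuD y01).
- exact: ccdf1_ae.
- by apply: ccdf1_ae; apply: filterS W01 => w /andP[].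
- by apply: cdf0_ae; apply: filterS W01 => w /andP[].
Qed.

Theorem theorem3p1 (R : realType) (d : nat) (hd : (0 < d)%N) :
  exists (dQ : measure_display) (TQ : measurableType dQ)
         (PQ : probability TQ R) (Q : {RV PQ >-> R}),
    [/\ forall (dT : measure_display) (T : measurableType dT)
          (P : probability T R) (U : nat -> {RV P >-> d.-tuple R}),
          iid_uniform_cube U ->
          cvg_in_distribution P
            (fun n w => ong_max (mkseq (fun i => U i w) n)) Q,
        forall (dT : measure_display) (T : measurableType dT)
          (P : probability T R) (U : nat -> {RV P >-> d.-tuple R})
          (N : R -> {RV P >-> nat}),
          iid_uniform_cube U -> unit_poisson_process N ->
          indep_processes U N ->
          cvg_in_distribution P
            (fun n w => ong_max (mkseq (fun i => U i w) (N n%:R w))) Q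
      & d = 1%N ->
        [/\ forall (dT : measure_display) (T : measurableType dT)
              (P : probability T R) (V M1 M2 : {RV P >-> R}),
              uniform01 V -> max_dickman M1 -> max_dickman M2 ->
              indep_family P
                (fun i : 'I_3 => sigma_rv (tnth [tuple V; M1; M2] i)) ->
              eq_in_distribution PQ P Q
                (fun w => Num.max (V w * M1 w) ((1 - V w) * M2 w)),
            forall (dM : measure_display) (TM : measurableType dM)
              (PM : probability TM R) (M : {RV PM >-> R})
              (dT : measure_display) (T : measurableType dT)
              (P : probability T R) (U : nat -> {RV P >-> d.-tuple R}),
              max_dickman M -> iid_uniform_cube U ->
              cvg_in_distribution P
                (fun n w => ong_max (origin :: mkseq (fun i => U i w) n)) M
          & forall (dM : measure_display) (TM : measurableType dM)
              (PM : probability TM R) (M : {RV PM >-> R})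
              (dT : measure_display) (T : measurableType dT)
              (P : probability T R) (U : nat -> {RV P >-> d.-tuple R})
              (N : R -> {RV P >-> nat}),
              max_dickman M -> iid_uniform_cube U ->
              unit_poisson_process N -> indep_processes U N ->
              cvg_in_distribution P
                (fun n w =>
                   ong_max (origin :: mkseq (fun i => U i w) (N n%:R w))) M]].
Proof.
have infty_id (dT : measure_display) (T : measurableType dT) (P : probability T R) :
    \forall w \ae P, forall k, exists n0, forall n, (n0 <= n)%N -> (k <= n)%N.
  by apply: aeW => w k; exists k.
have [dQ [TQ [PQ [Q [H1 H2 H3]]]]] : exists (dQ : measure_display) (TQ : measurableType dQ)
    (PQ : probability TQ R) (Q : {RV PQ >-> R}),
  [/\ forall (dT : measure_display) (T : measurableType dT)
        (P : probability T R) (U : nat -> {RV P >-> d.-tuple R}),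
        iid_uniform_cube U ->
        cvg_in_distribution P (fun n w => ong_max (mkseq (fun i => U i w) n)) Q,
      forall (dT : measure_display) (T : measurableType dT)
        (P : probability T R) (U : nat -> {RV P >-> d.-tuple R})
        (N : R -> {RV P >-> nat}),
        iid_uniform_cube U -> unit_poisson_process N ->
        cvg_in_distribution P
          (fun n w => ong_max (mkseq (fun i => U i w) (N n%:R w))) Q
    & d = 1%N -> forall (dT : measure_display) (T : measurableType dT)
        (P : probability T R) (V M1 M2 : {RV P >-> R}),
        uniform01 V -> max_dickman M1 -> max_dickman M2 ->
        indep_family P (fun i : 'I_3 => sigma_rv (tnth [tuple V; M1; M2] i)) ->
        eq_in_distribution PQ P Q (fun w => Num.max (V w * M1 w) ((1 - V w) * M2 w))].
  (* If an iid sequence exists on some space, its pathwise limit serves as [Q]. *)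
  have [[dQ [TQ [PQ [U0 iid0]]]]|noU] := pselect (exists (dQ : measure_display)
      (TQ : measurableType dQ) (PQ : probability TQ R) (U : nat -> {RV PQ >-> d.-tuple R}),
      iid_uniform_cube U).
    exists dQ, TQ, PQ, (ong_limit_rv U0); split.
    - move=> dT T P U iidU.
      exact: (cvg_no_origin iid0 iidU (K := fun n _ => n)).
    - move=> dT T P U N iidU poisN.
      apply: (cvg_no_origin iid0 iidU (K := fun n w => N n%:R w)) => //.
      exact: poisson_process_infty.
    - move=> d1; subst d => dT T P V M1 M2 uV D1 D2 ind.
      have limE : ong_lim (fun i w => U0 i w) = ong_lim (fun i w => [tuple coord U0 i w]).
        by congr ong_lim; apply/funext => i; apply/funext => w; exact: coordE.
      apply: split_max_law => //.
        by apply: aeW => w /=; rewrite limE; exact: ong_lim1_le1.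
      move=> nu y nuD y01; rewrite /= limE.
      rewrite [LHS](ong_lim1_cdf (coord_unit iid0) (coord_indep iid0) nuD y01).
      have mh := measurable_right_cdf nu y.
      rewrite -(@ge0_integral_distribution _ _ _ _ _ PQ (coord U0 0%N)
        (fun v : R => right_cdf nu y v * right_cdf nu y (1 - v)%R)%E).
      - by apply: eq_measure_integral => B mB _; exact: (coord_law iid0 0 mB).
      - apply: emeasurable_funM => //; apply: (measurableT_comp mh).
        exact: measurable_funB.
      - by move=> v; rewrite mule_ge0// right_cdf_ge0.
  have noU' (dT : measure_display) (T : measurableType dT) (P : probability T R)
      (U : nat -> {RV P >-> d.-tuple R}) : ~ iid_uniform_cube U.
    by move=> iidU; apply: noU; exists dT, T, P, U.
  (* Without iid sequences [Q] only has to match the split maximum: any realisation of it will do,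
     and if there is none, the constant 0. *)
  have [[dQ [TQ [PQ [V [M1 [M2 [uV D1 D2 ind]]]]]]]|noV] := pselect
      (exists (dQ : measure_display) (TQ : measurableType dQ)
        (PQ : probability TQ R) (V M1 M2 : {RV PQ >-> R}),
      [/\ uniform01 V, max_dickman M1, max_dickman M2 &
       indep_family PQ (fun i : 'I_3 => sigma_rv (tnth [tuple V; M1; M2] i))]).
    exists dQ, TQ, PQ, (HB.pack_for {mfun TQ >-> R} (split_max V M1 M2)
      (isMeasurableFun.Build _ _ _ _ _ (measurable_split_max V M1 M2))).
    split=> [dT T P U /noU'|dT T P U N /noU'|_ dT T P V' M1' M2' uV' D1' D2' ind']//.
    apply: split_max_law => //.
      apply: filterS (split_max_ae uV (max_dickman_law D1) (max_dickman_law D2)).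
      by move=> w /andP[].
    by move=> nu y nuD y01; exact: (split_max_integral uV D1 D2 ind).
  exists _, R, (unif01 R), (cst 0 : {mfun R >-> R}).
  split=> [dT T P U /noU'|dT T P U N /noU'|_ dT T P V M1 M2 uV D1 D2 ind]//.
  by exfalso; apply: noV; exists dT, T, P, V, M1, M2.
exists dQ, TQ, PQ, Q; split => [//|dT T P U N iidU poisN _|d1]; first exact: H2.
split; first exact: H3.
  subst d => dM TM PM M dT T P U DM iidU.
  exact: (cvg_origin iidU DM (K := fun n _ => n)).
subst d => dM TM PM M dT T P U N DM iidU poisN _.
apply: (cvg_origin iidU DM (K := fun n w => N n%:R w)) => //.
exact: poisson_process_infty.
Qed.
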